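(* Let $S$ be a Damek--Ricci space with right Haar measure $\rho$. The noncentred maximal operators $M^{\mathcal R^0}$, $M^{\mathcal R^\infty}$ and $M^{\mathcal D^\infty}$, associated respectively to the family $\mathcal R^0$ of small balls, the family $\mathcal R^\infty$ of big rectangles and the family $\mathcal D^\infty$ of big admissible sets, are bounded from $L^1(\rho)$ to $L^{1,\infty}(\rho)$.
   Context: **Damek--Ricci spaces.** Let $\mathfrak n$ be a finite-dimensional real Lie algebra with inner product and norm $|\cdot|$, and $\mathfrak n=\mathfrak v\oplus\mathfrak z$ an orthogonal decomposition with $[\mathfrak n,\mathfrak z]=\{0\}$, $[\mathfrak n,\mathfrak n]\subseteq\mathfrak z$. For $Z\in\mathfrak z$ define $J_Z:\mathfrak v\to\mathfrak v$ by $\langle J_ZX,Y\rangle=\langle Z,[X,Y]\rangle$. $\mathfrak n$ is of $H$-type if $|J_ZX|=|Z||X|$ for all $X\in\mathfrak v$, $Z\in\mathfrak z$ (the abelian case $\mathfrak v=\mathbb R^d$, $d\ge 1$, $\mathfrak z=\{0\}$ is also allowed). $N=\mathfrak v\times\mathfrak z$ is the group with product $(X,Z)(X',Z')=(X+X',Z+Z'+\frac12[X,X'])$, Haar measure $|\cdot|=dX\,dZ$, identity $0_N$. Homogeneous norm $\mathcal N(X,Z)=(|X|^4/16+|Z|^2)^{1/4}$, distance $d_N(n,n')=\mathcal N(n^{-1}n')$, balls $B_N(n,r)$. $Q=(m_{\mathfrak v}+2m_{\mathfrak z})/2$, with $m_{\mathfrak v}=\dim\mathfrak v$, $m_{\mathfrak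 z}=\dim\mathfrak z$. $S=N\times\mathbb R^+$ with product $(X,Z,a)(X',Z',a')=(X+a^{1/2}X',Z+aZ'+\frac12a^{1/2}[X,X'],aa')$, identity $e=(0,0,1)$, right Haar measure $d\rho=a^{-1}dX\,dZ\,da$. $d$ is the left-invariant Riemannian distance on $S$ whose metric at $e$ is the inner product of $\mathfrak n$ extended to $\mathfrak s=\mathfrak n\oplus\mathbb RH$ by making $H$ (tangent to $t\mapsto(0,0,e^t)$ at $t=0$) a unit vector orthogonal to $\mathfrak n$; $B(x,r)$ are its balls. **Maximal operators.** For a family $\mathcal F$ of open subsets of $S$, $M^{\mathcal F}f(x)=\sup_{F\in\mathcal F,\,x\in F}\frac1{\rho(F)}\int_F|f|\,d\rho$ for $f\in L^1_{\rm loc}(\rho)$. $L^{1,\infty}(\rho)$ is the space of measurable $f$ with $\sup_{t>0}t\,\rho(\{|f|>t\})<\infty$. **The families.** (a) $\mathcal R^0=\{B(x_0,r):x_0\in S,\ r<1/2\}$. (b) Fix constants $1/2<b'<b''$. For $r\ge\mathrm e$ (the base of natural logarithms) put $E_{r,b}=B_N(0_N,r^b)\times(1/r,r)$; $\mathcal R^\infty=\{x_0E_{r,b}:x_0\in S,\ r\ge\mathrm e,\ b'<b<b''\}$ (left translates). (c) Dyadic sets (M. Christ): fix a collection of open sets $Q^k_\alpha\subset N$, $k\in\mathbb Z$, $\alpha\in I_k$ ($I_k$ countable), constants $\eta>1$, $c_N,C_N>0$, an integer $M$, and points $n^k_\alpha\in N$ such that: $|N\setminus\bigcup_{\alpha\in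 I_k}Q^k_\alpha|=0$ for all $k$; $B_N(n^k_\alpha,c_N\eta^k)\subseteq Q^k_\alpha\subseteq B_N(n^k_\alpha,C_N\eta^k)$; $Q^k_\alpha\cap Q^k_\beta=\emptyset$ if $\alpha\ne\beta$; each $Q^k_\alpha$ has at most $M$ subsets of type $Q^{k-1}_\beta$; for $\ell\le k$ and $\beta\in I_\ell$ there is a unique $\alpha\in I_k$ with $Q^\ell_\beta\subseteq Q^k_\alpha$; for $\ell\le k$ either $Q^k_\alpha\cap Q^\ell_\beta=\emptyset$ or $Q^\ell_\beta\subseteq Q^k_\alpha$. Let $c_3$ be a constant such that $B(e,\log r)\subseteq B_N(0_N,c_3r)\times(1/r,r)$ for all $r>1$ and fix a constant $\beta>\max\{3/2,\ 1/4+\log\eta,\ 1+\log(c_3/c_N)\}$. $\mathcal D^\infty$ is the family of all big admissible sets, i.e. sets $Q^k_\alpha\times(a_0/r,a_0r)$ with $a_0>0$, $r\ge\mathrm e$ and $a_0^{1/2}r^\beta\le\eta^k<a_0^{1/2}r^{4\beta}$. *)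

(* Defs.v *)
From HB Require Import structures.
From mathcomp Require Import all_boot all_order all_algebra.
From mathcomp Require Import sesquilinear.
From mathcomp Require Import all_classical all_reals all_analysis.
From mathcomp Require Import measurable_realfun.

Set Implicit Arguments.
Unset Strict Implicit.
Unset Printing Implicit Defensive.

Import Order.TTheory GRing.Theory Num.Theory.
Import numFieldNormedType.Exports.

Local Open Scope classical_set_scope.
Local Open Scope ring_scope.

(* A nonzero H-type algebra n = v + z, including the abelian ones (z = 0).    *)
(* [htype_J Z X] is J_Z X, determined on z x v by [htype_JP]; off z x v its   *)
(* values are irrelevant.                                                     *)
Record htype_algebra (R : realType) := HTypeAlgebra {
  htype_carrier :> vectType R ;
  htype_lie :
    {bilinear htype_carrier -> htype_carrier -> htype_carrier} ;
  htype_ip : {dot htype_carrier for idfun} ;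
  htype_v : {vspace htype_carrier} ;
  htype_z : {vspace htype_carrier} ;
  htype_J : htype_carrier -> htype_carrier -> htype_carrier ;
  htype_nontrivial : (0 < \dim {: htype_carrier})%N ;
  htype_alternating : forall x, htype_lie x x = 0 ;
  htype_jacobi : forall x y z,
    htype_lie x (htype_lie y z) + htype_lie y (htype_lie z x)
      + htype_lie z (htype_lie x y) = 0 ;
  htype_sum : (htype_v + htype_z)%VS = {: htype_carrier}%VS ;
  htype_orthogonal : forall x z, x \in htype_v -> z \in htype_z ->
    htype_ip x z = 0 ;
  htype_central : forall x z, z \in htype_z -> htype_lie x z = 0 ;
  htype_derived : forall x y, htype_lie x y \in htype_z ;
  htype_J_v : forall z x, z \in htype_z -> x \in htype_v ->
    htype_J z x \in htype_v ;
  htype_JP : forall z x y, z \in htype_z -> x \in htype_v -> y \in htype_v ->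
    htype_ip (htype_J z x) y = htype_ip z (htype_lie x y) ;
  htype_norm : forall z x, z \in htype_z -> x \in htype_v ->
    Num.sqrt (htype_ip (htype_J z x) (htype_J z x)) =
    Num.sqrt (htype_ip z z) * Num.sqrt (htype_ip x x)
}.

Arguments htype_lie {R} g : rename.
Arguments htype_ip {R} g : rename.

Definition orthonormal_basis (R : realType) (g : htype_algebra R)
    (U : {vspace g}) (m : nat) (e : m.-tuple g) : Prop :=
  basis_of U e /\ orthonormal (htype_ip g) e.

(* The group N = v x z is written in coordinates: v and z are identified with *)
(* 'rV[R]_mv and 'rV[R]_mz through orthonormal bases ev and ez, so that inner *)
(* products become the standard ones. This is the bracket v x v -> z in these *)
(* coordinates.                                                               *)
Definition coord_bracket (R : realType) (g : htype_algebra R) (mv mz : nat)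
    (ev : mv.-tuple g) (ez : mz.-tuple g) (X Y : 'rV[R]_mv) : 'rV[R]_mz :=
  \row_(k < mz) htype_ip g
    (htype_lie g (\sum_(i < mv) X ord0 i *: tnth ev i)
                 (\sum_(j < mv) Y ord0 j *: tnth ev j)) (tnth ez k).

(* 'rV[R]_n carries the sigma-algebra generated by the coordinates, i.e. the  *)
(* Borel one.                                                                 *)
Section measurable_rV.
Context (R : realType) (n : nat).

Let coors : 'I_n -> 'rV[R]_n -> R := fun i X => X ord0 i.

Let rV_set0 : g_sigma_preimage coors set0.
Proof. exact: sigma_algebra0. Qed.

Let rV_setC A : g_sigma_preimage coors A -> g_sigma_preimage coors (~` A).
Proof. exact: sigma_algebraC. Qed.

Let rV_bigcup (F : (set 'rV[R]_n)^nat) :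
  (forall i, g_sigma_preimage coors (F i)) ->
  g_sigma_preimage coors (\bigcup_i F i).
Proof. exact: sigma_algebra_bigcup. Qed.

HB.instance Definition _ :=
  @isMeasurable.Build (measure_tuple_display default_measure_display)
    'rV[R]_n (g_sigma_preimage coors) rV_set0 rV_setC rV_bigcup.

Lemma measurable_coord (i : 'I_n) :
  measurable_fun [set: 'rV[R]_n] (fun X => X ord0 i : R).
Proof.
move=> _ Y mY; rewrite setTI; apply: sub_sigma_algebra => /=.
rewrite -bigcup_seq/=; exists i => /=; first by rewrite mem_index_enum.
by exists Y => //; rewrite setTI.
Qed.

Lemma measurable_fun_rVP d (T : measurableType d) (f : T -> 'rV[R]_n) :
  (forall i, measurable_fun [set: T] (fun t => f t ord0 i : R)) ->
  measurable_fun [set: T] f.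
Proof.
move=> mf _ A mA; rewrite setTI.
have : preimage_set_system [set: T] f (g_sigma_preimage coors) (f @^-1` A).
  by exists A => //; rewrite setTI.
rewrite -g_sigma_preimage_comp; apply: smallest_sub; first exact: sigma_algebra_measurable.
move=> B; rewrite -bigcup_seq => -[i _ [C mC <-]].
exact: (mf i).
Qed.

End measurable_rV.

Section lebesgue_rV.
Variable R : realType.

Definition rV_cons (n : nat) (p : R * 'rV[R]_n) : 'rV[R]_n.+1 :=
  \row_i if unlift ord0 i is Some j then p.2 ord0 j else p.1.

Let rV_uncons (n : nat) (X : 'rV[R]_n.+1) : R * 'rV[R]_n :=
  (X ord0 ord0, \row_j X ord0 (lift ord0 j)).

Lemma measurable_rV_cons (n : nat) : measurable_fun setT (@rV_cons n).
Proof.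
apply: measurable_fun_rVP => i; under eq_fun do rewrite mxE.
case: (unliftP ord0 i) => [j _|_]; last exact: measurable_fst.
exact: (measurableT_comp (@measurable_coord R n j) (@measurable_snd _ _ R 'rV[R]_n)).
Qed.

Let measurable_rV_uncons (n : nat) : measurable_fun setT (@rV_uncons n).
Proof.
apply/measurable_fun_pairP; split => /=; first exact: measurable_coord.
apply: measurable_fun_rVP => i; rewrite [X in measurable_fun _ X](_ : _ =
  fun X : 'rV[R]_n.+1 => X ord0 (lift ord0 i)); last first.
  by apply/funext => X; rewrite /= mxE.
exact: measurable_coord.
Qed.

Let rV_consK (n : nat) : cancel (@rV_cons n) (@rV_uncons n).
Proof.
move=> [x X]; rewrite /rV_uncons mxE unlift_none/=; congr (_, _).
by apply/rowP => j; rewrite !mxE liftK.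
Qed.

Section step.
Local Open Scope ereal_scope.
Context (n : nat) (m : {sigma_finite_measure set 'rV[R]_n -> \bar R}).

Local Notation prod_measure := ((@lebesgue_measure R) \x m).

Definition lebesgue_rV_step := pushforward prod_measure (@rV_cons n).

Let push := measure_function_pushforward__canonical__measure_function_Measure
  prod_measure (@measurable_rV_cons n).

Let step0 : lebesgue_rV_step set0 = 0.
Proof. exact: (@measure0 _ _ _ push). Qed.

Let step_ge0 A : 0 <= lebesgue_rV_step A.
Proof. exact: (@measure_ge0 _ _ _ push). Qed.

Let step_sigma_additive : semi_sigma_additive lebesgue_rV_step.
Proof. exact: (@measure_semi_sigma_additive _ _ _ push). Qed.

HB.instance Definition _ := isMeasure.Build _ _ _ lebesgue_rV_step
  step0 step_ge0 step_sigma_additive.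

Let step_sigma_finite : sigma_finite setT lebesgue_rV_step.
Proof.
have /sigma_finiteP[F [TF ndF Foo]] := sigma_finiteT (@lebesgue_measure R).
have /sigma_finiteP[G [TG ndG Goo]] := sigma_finiteT m.
exists (fun k => @rV_uncons n @^-1` (F k `*` G k)).
  rewrite -preimage_bigcup (_ : \bigcup_i _ = setT) ?preimage_setT//.
  rewrite -setXTT TF TG predeqE => -[x y]; split; last first.
    move=> [/= [i _ Fix] [j _ Gjy]]; exists (maxn i j) => //; split.
    - by move: x Fix; exact/subsetPset/ndF/leq_maxl.
    - by move: y Gjy; exact/subsetPset/ndG/leq_maxr.
  by move=> [i _ []/= ? ?]; split; exists i.
move=> k; have [mF Fkoo] := Foo k; have [mG Gkoo] := Goo k.
have mFG : measurable (F k `*` G k : set (R * 'rV[R]_n)) by exact: measurableX.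
split.
  by rewrite -[X in measurable X]setTI; exact: measurable_rV_uncons.
rewrite /lebesgue_rV_step /pushforward -comp_preimage.
rewrite (_ : _ \o _ = id); last by apply/funext => p; exact: rV_consK.
by rewrite preimage_id product_measure1E// lte_mul_pinfty// ge0_fin_numE.
Qed.

HB.instance Definition _ := Measure_isSigmaFinite.Build _ _ _ lebesgue_rV_step
  step_sigma_finite.

End step.

(* Lebesgue measure on R^n, as the n-fold product of the one on R.            *)
Fixpoint lebesgue_rV (n : nat) : {sigma_finite_measure set 'rV[R]_n -> \bar R} :=
  match n with
  | 0 => @dirac _ 'rV[R]_0 0 R
  | n'.+1 => lebesgue_rV_step (lebesgue_rV n')
  end.

End lebesgue_rV.

(* N = v x z is 'rV[R]_mv * 'rV[R]_mz and S = N x R^+ is the subset           *)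
(* [S_domain] of ('rV[R]_mv * 'rV[R]_mz) * R.                                 *)

Section right_haar_measure.
Context (R : realType) (mv mz : nat).
Local Notation N := ('rV[R]_mv * 'rV[R]_mz)%type.
Local Notation T := (N * R)%type.
Local Open Scope ereal_scope.

Definition N_haar : set N -> \bar R := lebesgue_rV R mv \x lebesgue_rV R mz.

HB.instance Definition _ := Measure.on N_haar.

Definition S_domain : set T := [set x | (0 < x.2)%R].

Definition S_haar (A : set T) : \bar R :=
  \int[N_haar \x @lebesgue_measure R]_(x in A `&` S_domain) (x.2^-1)%:E.

Lemma measurable_S_domain : measurable S_domain.
Proof.
rewrite -[X in measurable X]setTI.
rewrite (_ : S_domain = snd @^-1` `]0%R, +oo[%classic).
  by apply: (@measurable_snd _ _ N R) => //; exact: measurable_itv.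
by apply/seteqP; split=> x /=; rewrite in_itv/= andbT.
Qed.

Let measurable_density :
  measurable_fun S_domain (EFin \o (fun x : T => x.2^-1)%R).
Proof.
apply/measurable_EFinP.
pose D : set R := `]0%R, +oo[%classic.
have minv : measurable_fun D (fun a : R => a^-1%R).
  apply: open_continuous_measurable_fun; first exact: interval_open.
  move=> a; rewrite inE /D/= in_itv/= andbT => a0.
  by apply: inv_continuous; rewrite gt_eqF.
apply: (measurable_comp (F := D) _ _ minv).
- exact: measurable_itv.
- by move=> _ [x x0 <-]; rewrite /D/= in_itv/= andbT.
- exact: (measurable_funTS (@measurable_snd _ _ N R)).
Qed.

Let density_ge0 (x : T) : S_domain x -> 0 <= (x.2^-1)%:E.
Proof. by move=> x0; rewrite lee_fin invr_ge0 ltW. Qed.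

Let S_haar0 : S_haar set0 = 0.
Proof. by rewrite /S_haar set0I integral_set0. Qed.

Let S_haar_ge0 A : 0 <= S_haar A.
Proof. by apply: integral_ge0 => x [_]; exact: density_ge0. Qed.

Let S_haar_sigma_additive : semi_sigma_additive S_haar.
Proof.
move=> F mF tF mUF; rewrite /S_haar setI_bigcupl ge0_integral_bigcup//.
- by apply: is_cvg_nneseries => n _ _; exact: S_haar_ge0.
- by move=> k; apply: measurableI; [exact: mF|exact: measurable_S_domain].
- apply: (measurable_funS _ _ measurable_density).
    exact: measurable_S_domain.
  by move=> x [k _ []].
- by move=> x [k _ [_]]; exact: density_ge0.
- exact: trivIset_setIr.
Qed.

HB.instance Definition _ := isMeasure.Build _ _ _ S_haar
  S_haar0 S_haar_ge0 S_haar_sigma_additive.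

(* The supremum is taken in [0, +oo], i.e. it is 0 over the empty set: almost *)
(* every point of S, but not every one, lies in a big admissible set.         *)
Definition maximal (F : set (set T)) (f : T -> R) (x : T) : \bar R :=
  ereal_sup ([set 0] `|`
    [set (S_haar A)^-1 * \int[S_haar]_(y in A) `|f y|%:E
      | A in [set A | F A /\ A x]]).

Definition weak_L1_norm (g : T -> \bar R) : \bar R :=
  ereal_sup [set t%:E * S_haar (S_domain `&` [set x | t%:E < `|g x|])
    | t in [set t : R | (0 < t)%R]].

Definition bounded_L1_weak_L1 (M : (T -> R) -> T -> \bar R) : Prop :=
  exists C : R, forall f : T -> R,
    S_haar.-integrable S_domain (EFin \o f) ->
    measurable_fun S_domain (M f) /\
    weak_L1_norm (M f) <= C%:E * \int[S_haar]_(x in S_domain) `|f x|%:E.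

End right_haar_measure.

Section damek_ricci.
Context (R : realType) (mv mz : nat).
Context (br : 'rV[R]_mv -> 'rV[R]_mv -> 'rV[R]_mz).
Local Notation N := ('rV[R]_mv * 'rV[R]_mz)%type.
Local Notation T := (N * R)%type.

(* The library norm on row vectors is the sup norm.                           *)
Definition enorm (n : nat) (X : 'rV[R]_n) : R :=
  Num.sqrt (\sum_(i < n) X ord0 i ^+ 2).

Definition N_mul (n n' : N) : N :=
  (n.1 + n'.1, n.2 + n'.2 + 2^-1 *: br n.1 n'.1).

Definition N_inv (n : N) : N := (- n.1, - n.2).

Definition N_one : N := (0, 0).

Definition N_norm (n : N) : R :=
  (enorm n.1 ^+ 4 / 16 + enorm n.2 ^+ 2) `^ 4^-1.

Definition N_dist (n n' : N) : R := N_norm (N_mul (N_inv n) n').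

Definition N_ball (n : N) (r : R) : set N := [set n' | N_dist n n' < r].

Definition S_mul (x y : T) : T :=
  ((x.1.1 + Num.sqrt x.2 *: y.1.1,
    x.1.2 + x.2 *: y.1.2 + (2^-1 * Num.sqrt x.2) *: br x.1.1 y.1.1),
   x.2 * y.2).

Definition S_inv (x : T) : T :=
  ((- ((Num.sqrt x.2)^-1 *: x.1.1), - (x.2^-1 *: x.1.2)), x.2^-1).

Definition S_one : T := (N_one, 1).

(* The norm of s = v + z + R H; H, tangent at e to (0, 0, expR t), is the     *)
(* vector (0, 0, 1).                                                          *)
Definition s_norm (u : T) : R :=
  Num.sqrt (enorm u.1.1 ^+ 2 + enorm u.1.2 ^+ 2 + u.2 ^+ 2).

(* The norm at x of a tangent vector u: the norm of its image in s under the  *)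
(* differential at x of the left translation by the inverse of x.             *)
Definition S_metric (x u : T) : R :=
  s_norm ('D_u (S_mul (S_inv x)) x).

(* A C^1 arc is a C^1 map on [0, 1]; it always extends to a C^1 map on R.     *)
Definition C1_arc (c : R -> T) : Prop :=
  [/\ forall t, derivable c t 1, continuous (c^`()%classic) &
      forall t, t \in `[0, 1] -> S_domain (c t)].

Definition arc_length (c : R -> T) : R :=
  \int[@lebesgue_measure R]_(t in `[0%R, 1%R]) S_metric (c t) (c^`()%classic t).

(* [S_path x y l]: some piecewise C^1 curve of length l joins x to y.         *)
Inductive S_path : T -> T -> R -> Prop :=
| S_path_nil x of S_domain x : S_path x x 0
| S_path_cons c y l of C1_arc c & S_path (c 1) y l :
    S_path (c 0) y (arc_length c + l).

Definition S_dist (x y : T) : \bar R :=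
  ereal_inf [set l%:E | l in [set l | S_path x y l]].

Definition S_ball (x : T) (r : R) : set T :=
  [set y | S_domain y /\ (S_dist x y < r%:E)%E].

Definition small_balls : set (set T) :=
  [set A | exists x r, [/\ S_domain x, r < 2^-1 & A = S_ball x r]].

Definition rectangle (r b : R) : set T :=
  N_ball N_one (r `^ b) `*` `]r^-1, r[.

Definition big_rectangles (b' b'' : R) : set (set T) :=
  [set A | exists x r b, [/\ S_domain x, expR 1 <= r, b' < b < b'' &
    A = [set S_mul x y | y in rectangle r b]]].

Record christ_sets (I : int -> countType) (Q : forall k, I k -> set N)
    (eta cN CN : R) (M : nat) (center : forall k, I k -> N) : Prop :=
  ChristSets {
    christ_open : forall k a, open (Q k a) ;
    christ_cover : forall k, N_haar (~` \bigcup_a Q k a) = 0%E ;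
    christ_balls : forall k a,
      N_ball (center k a) (cN * eta ^ k) `<=` Q k a /\
      Q k a `<=` N_ball (center k a) (CN * eta ^ k) ;
    christ_disjoint : forall k a b, a <> b -> Q k a `&` Q k b = set0 ;
    christ_children : forall k a,
      ([set b | Q (k - 1) b `<=` Q k a] #<= `I_M)%card ;
    christ_parent : forall l k b, l <= k ->
      exists! a : I k, Q l b `<=` Q k a ;
    christ_nested : forall l k a b, l <= k ->
      Q k a `&` Q l b = set0 \/ Q l b `<=` Q k a
  }.

Definition big_admissible (I : int -> countType)
    (Q : forall k, I k -> set N) (eta beta : R) : set (set T) :=
  [set A | exists k a a0 r, [/\ 0 < a0, expR 1 <= r,
    Num.sqrt a0 * r `^ beta <= eta ^ k < Num.sqrt a0 * r `^ (4 * beta) &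
    A = Q k a `*` `]a0 / r, a0 * r[]].

End damek_ricci.

(* Main.v *)
Require Import Defs.
From HB Require Import structures.
From mathcomp Require Import all_boot all_order all_algebra.
From mathcomp Require Import sesquilinear.
From mathcomp Require Import all_classical all_reals all_analysis.
From mathcomp Require Import measurable_realfun.
From mathcomp Require Import ring lra.

Set Implicit Arguments.
Unset Strict Implicit.
Unset Printing Implicit Defensive.

Import Order.TTheory GRing.Theory Num.Theory.
Import numFieldNormedType.Exports.

Local Open Scope classical_set_scope.
Local Open Scope ring_scope.

(* Every set of the three families contains, and is contained in, a product   *)
(* of a box of N, of sizes u in v and v in z, and a logarithmic interval      *)
(* (a e^-l, a e^l), the inner and outer sizes being comparable. For such      *)
(* products rho is (2u)^mv (2v)^mz 2l, so it is doubling in u, v and l. If    *)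
(* moreover the sizes of a set are controlled by those of any set that it     *)
(* meets and that has a larger scale, the Vitali covering argument gives the  *)
(* weak type (1,1). The scale is the radius for small balls. For the big      *)
(* families it is the radius s of the N-component: there                      *)
(* a^1/2 e^(b1 l) <= s <= a^1/2 e^(b2 l) with b1 > 1/2, and when the          *)
(* intervals meet and s' <= s, this gives l' <= (b2 + 1/2) / (b1 - 1/2) l.    *)

(** For t >= 0 the set where a maximal function exceeds t is the union of the sets of the family on
    which the mean of |f| exceeds t. It is open, so the Lindelof property makes it a countable
    union, and [vitali_bigcup] bounds its measure as soon as each set F has an enlargement E, of
    measure at most C rho(F), that contains every set of smaller scale meeting F. This is
    [bounded_L1_weak_L1_vitali], and [bounded_L1_weak_L1_box_family] supplies E for sets trapped
    between boxes. The sizes u in v and v in z are independent, because a small ball at height a has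
    sizes a^1/2 r and a r, whereas a ball of radius s in N has sizes s and s^2. In both cases u^2 <=
    K1 v, so the bracket terms, quadratic in u, are absorbed by v.

    The big families are described by boxes almost by definition: a translated rectangle is a ball
    of N times a logarithmic interval ([translate_rectangle]), and a dyadic set lies between two
    balls; [bounded_L1_weak_L1_big_sets] treats both. For small balls the outer box comes from
    integrating the left-invariant velocity along an arbitrary curve ([S_path_estimate]), and the
    inner one from the length of a segment that is straight in the coordinates ([S_path_box]). *)

Section rV_topology.
Context (R : realType).

Lemma norm_rV_lt n (X : 'rV[R]_n) u : 0 < u ->
  (`|X| < u) <-> forall i, `|X ord0 i| < u.
Proof.
move=> u0; rewrite {1}/Num.norm/= mx_normrE; split=> [/bigmax_ltP[_ H] i|H].
  exact: (H (ord0, i)).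
by apply/bigmax_ltP; split=> // -[i j] _; rewrite ord1; exact: H.
Qed.

Lemma norm_rV_le n (X : 'rV[R]_n) u : 0 <= u ->
  (`|X| <= u) <-> forall i, `|X ord0 i| <= u.
Proof.
move=> u0; rewrite {1}/Num.norm/= mx_normrE; split=> [/bigmax_leP[_ H] i|H].
  exact: (H (ord0, i)).
by apply/bigmax_leP; split=> // -[i j] _; rewrite ord1; exact: H.
Qed.

Lemma ler_norm_rV n (X : 'rV[R]_n) i : `|X ord0 i| <= `|X|.
Proof. exact: ((norm_rV_le X (normr_ge0 X)).1 (lexx _)). Qed.

Lemma ball_rV n (X : 'rV[R]_n) u Y : 0 < u ->
  ball X u Y <-> forall i, `|X ord0 i - Y ord0 i| < u.
Proof.
move=> u0; rewrite -ball_normE/= (norm_rV_lt _ u0).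
by split=> H i; have := H i; rewrite !mxE.
Qed.

(** The sigma-algebra is generated by the coordinates, and a sup-norm ball is a finite intersection
    of conditions on single coordinates. *)
Lemma measurable_ball_rV n (X : 'rV[R]_n) u : measurable (ball X u).
Proof.
have [u0|u0] := leP u 0; first
  suff -> : ball X u = set0 by [].
  rewrite eqEsubset; split=> // Y.
  by rewrite -ball_normE/= => h; have := normr_ge0 (X - Y); lra.
rewrite (_ : ball X u = \bigcap_(i in [set: 'I_n])
   ((fun Y : 'rV[R]_n => Y ord0 i) @^-1` ball (X ord0 i) u)); last first.
  apply/seteqP; split=> Y /=; first by move/(ball_rV _ _ u0) => H i _; exact: H.
  by move=> H; apply/(ball_rV _ _ u0) => i; exact: H.
apply: fin_bigcap_measurable => // i _; rewrite -[X in measurable X]setTI.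
by apply: (@measurable_coord R n i) => //; exact: measurable_ball.
Qed.

End rV_topology.

Section rational_boxes.
Context (R : realType) (mv mz : nat).
Local Notation N := ('rV[R]_mv * 'rV[R]_mz)%type.
Local Notation T := (N * R)%type.

(** A base of the topology indexed by a countable type. Each member is a product of balls, hence
    measurable for the product sigma-algebra. *)
Definition rational_ball (b : ('rV[rat]_mv * 'rV[rat]_mz) * rat * nat) : set T :=
  ball (((map_mx ratr b.1.1.1, map_mx ratr b.1.1.2), ratr b.1.2) : T) b.2.+1%:R^-1.

Lemma measurable_rational_ball b : measurable (rational_ball b).
Proof.
have -> : rational_ball b =
    (ball (map_mx ratr b.1.1.1 : 'rV[R]_mv) b.2.+1%:R^-1 `*`
     ball (map_mx ratr b.1.1.2 : 'rV[R]_mz) b.2.+1%:R^-1) `*`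
    ball (ratr b.1.2 : R) b.2.+1%:R^-1.
  by apply/seteqP; split=> -[[x y] z]; rewrite /rational_ball.
apply: measurableX; last exact: measurable_ball.
by apply: measurableX => /=; exact: measurable_ball_rV.
Qed.

(** A sigma type rather than [exists], so that [near_map_ratr] can assemble a row vector from the
    chosen rationals. *)
Lemma near_ratr (x e : R) : 0 < e -> {q : rat | `|x - ratr q| < e}.
Proof.
move=> e0; apply: cid.
have /rat_in_itvoo[q] : x < x + e by rewrite ltrDl.
rewrite in_itv/= => /andP[h1 h2]; exists q.
by rewrite ltr_norml; apply/andP; split; lra.
Qed.

Lemma near_map_ratr n (X : 'rV[R]_n) (e : R) : 0 < e ->
  exists q : 'rV[rat]_n, ball X e (map_mx ratr q).
Proof.
move=> e0; exists (\row_i sval (near_ratr (X ord0 i) e0)).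
apply/ball_rV => // i; rewrite !mxE; exact: (svalP (near_ratr _ e0)).
Qed.

Lemma open_rational_ball (U : set T) x : open U -> U x ->
  exists b, rational_ball b x /\ rational_ball b `<=` U.
Proof.
move=> oU Ux; have /nbhs_ballP[e /= e0 eU] := open_nbhs_nbhs (conj oU Ux).
(* Half of [e]: both x and the points of the rational ball are within 1/(n+1) of its centre. *)
have [n ne] : exists n : nat, n.+1%:R^-1 < e / 2.
  have e20 : 0 < e / 2 by rewrite divr_gt0.
  exists (Num.truncn (e / 2)^-1).
  by rewrite invf_plt ?posrE ?ltr0n// truncnS_gt.
have d0 : 0 < n.+1%:R^-1 :> R by rewrite invr_gt0 ltr0n.
case: x => [[X Z] a] in Ux eU *.
have [q qX] := near_map_ratr X d0; have [p pZ] := near_map_ratr Z d0.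
have [c ca] := near_ratr a d0.
have xb : ball (((X, Z), a) : T) n.+1%:R^-1
    (((map_mx ratr q, map_mx ratr p), ratr c) : T) by [].
exists ((q, p), c, n); split; first exact: ball_sym.
move=> y yb; apply: eU.
  have ne2 : n.+1%:R^-1 + n.+1%:R^-1 <= e by rewrite [leRHS]splitr; apply: lerD; exact: ltW.
  apply: (le_ball ne2).
  exact: ball_triangle yb.
Qed.

Lemma open_measurable_T (U : set T) : open U -> measurable U.
Proof.
move=> oU; rewrite (_ : U = \bigcup_(b in [set b | rational_ball b `<=` U])
  rational_ball b); last first.
  apply/seteqP; split=> [x Ux|x [b /= bU /bU]//].
  by have [b [bx bU]] := open_rational_ball oU Ux; exists b.
rewrite bigcup_mkcond; apply: countable_bigcupT_measurable => // b.
by case: ifP => // _; exact: measurable_rational_ball.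
Qed.

(** For each rational ball contained in some [F j], one such [j] is chosen; these sets already cover
    the union. The index [j0] stands in for balls contained in no [F j] and for integers that code
    no ball. *)
Lemma open_lindelof (J : Type) (P : set J) (F : J -> set T) :
  (forall j, P j -> open (F j)) -> P !=set0 ->
  exists k : nat -> J, (forall n, P (k n)) /\
    \bigcup_(j in P) F j = \bigcup_n F (k n).
Proof.
move=> oF [j0 Pj0].
pose good b j := P j /\ rational_ball b `<=` F j.
have /choice[c cP] b : exists j, P j /\ ((exists j, good b j) -> good b j).
  have [[j gj]|ng] := pselect (exists j, good b j); last by exists j0.
  by exists j; split => //; exact: gj.1.
exists (fun n => if unpickle n is Some b then c b else j0); split.
  by move=> n; case: unpickle => // b; exact: (cP b).1.
apply/seteqP; split=> x [j Pj Fx]; last first.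
  by move: Fx; case: unpickle => [b|] Fx; [exists (c b)|exists j0] => //;
    exact: (cP b).1.
have [b [bx bF]] := open_rational_ball (oF _ Pj) Fx.
exists (pickle b) => //=; rewrite pickleK.
by apply: ((cP b).2 _).2 => //; exists j.
Qed.

End rational_boxes.

(** * Covering argument *)

Section vitali.
Context d (T : measurableType d) (R : realType) (mu : {measure set T -> \bar R}).
Variables (W : set T) (F E : nat -> set T) (s : nat -> R) (f : T -> \bar R) (C : R).
Local Open Scope ereal_scope.
Hypothesis mF : forall i, measurable (F i).
Hypothesis mE : forall i, measurable (E i).
Hypothesis mW : measurable W.
Hypothesis FW : forall i, F i `<=` W.
Hypothesis F_neq0 : forall i, F i !=set0.
Hypothesis engulf : forall i j, (s j <= s i)%R -> F i `&` F j !=set0 ->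
  F j `<=` E i.
Hypothesis mf : measurable_fun W f.
Hypothesis f0 : forall x, 0 <= f x.
Hypothesis C0 : (0 <= C)%R.
Hypothesis mu_E : forall i, mu (E i) <= C%:E * \int[mu]_(x in F i) f x.

Lemma measurable_bigcup_seq (l : seq nat) (G : nat -> set T) :
  (forall i, measurable (G i)) -> measurable (\bigcup_(i in [set` l]) G i).
Proof. by move=> mG; apply: bigcup_measurable => i _. Qed.

Lemma max_scale (l : seq nat) : l != [::] ->
  exists2 i, i \in l & forall j, j \in l -> (s j <= s i)%R.
Proof.
elim: l => // a l IH _; have [->|/IH[i il H]] := eqVneq l [::].
  by exists a => [|j]; rewrite inE // => /eqP ->.
have [ai|/ltW ia] := leP (s a) (s i).
  by exists i => [|j]; rewrite inE ?il ?orbT// => /predU1P[->|/H].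
exists a => [|j]; rewrite inE ?eqxx// => /predU1P[->//|/H ji].
exact: le_trans ji ia.
Qed.

(* The set of largest scale dilated to [E] covers all the sets that it meets; *)
(* the remaining ones lie in its complement, which is why [D] is arbitrary.   *)
Lemma vitali_finite n (l : seq nat) (D : set T) : (size l <= n)%N ->
  measurable D -> D `<=` W -> (forall i, i \in l -> F i `<=` D) ->
  mu (\bigcup_(i in [set` l]) F i) <= C%:E * \int[mu]_(x in D) f x.
Proof.
elim: n l D => [|n IH] l D.
  rewrite leqn0 size_eq0 => /eqP -> mD DW _.
  rewrite (_ : [set` [::]] = set0) ?bigcup_set0 ?measure0; last first.
    by apply/seteqP; split.
  by apply: mule_ge0; [rewrite lee_fin|apply: integral_ge0].
move=> ln mD DW FD; have [l0|/max_scale[i il smax]] := eqVneq l [::].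
  by apply: IH => //; rewrite l0.
pose meets j := `[< F i `&` F j !=set0 >].
pose l' := [seq j <- l | ~~ meets j].
(* [F i] is nonempty, hence meets itself, so [l'] is strictly shorter than [l]. *)
have l'n : (size l' <= n)%N.
  rewrite -ltnS (leq_trans _ ln)// /l' size_filter -(count_predC meets l).
  rewrite -{1}[count _ _]add0n ltn_add2r -has_count; apply/hasP; exists i => //.
  by apply/asboolP; rewrite setIid; exact: F_neq0.
have mDF : measurable (D `\` F i) by exact: measurableD.
have DFW : D `\` F i `<=` W by move=> x [/DW].
have l'D j : j \in l' -> F j `<=` D `\` F i.
  rewrite mem_filter => /andP[/asboolPn jm jl] x Fjx.
  by split; [exact: (FD _ jl)|move=> Fix; apply: jm; exists x].
have := IH _ _ l'n mDF DFW l'D => IHl.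
rewrite (_ : D = F i `|` (D `\` F i)); last first.
  by rewrite setDUK//; exact: FD.
rewrite ge0_integral_setU//; last 2 first.
- rewrite setDUK; last exact: FD.
  exact: measurable_funS mf.
- by apply/disj_setPRL => x [].
rewrite ge0_muleDr; [|exact: integral_ge0|exact: integral_ge0].
apply: (le_trans (y := mu (E i) + mu (\bigcup_(i in [set` l']) F i))); last first.
  by apply: leeD.
apply: (le_trans (y := mu (E i `|` \bigcup_(i in [set` l']) F i))); last first.
  by apply: measureU2 => //; exact: measurable_bigcup_seq.
apply: le_measure; rewrite ?inE.
- exact: measurable_bigcup_seq.
- by apply: measurableU => //; exact: measurable_bigcup_seq.
move=> x [j /= jl Fjx]; have [jm|jm] := boolP (meets j).
  by left; apply: (engulf (smax _ jl)) Fjx; exact/asboolP.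
by right; exists j => //=; rewrite mem_filter jm.
Qed.

(** The finite bound does not depend on the number of sets, so it passes to increasing unions by
    continuity of the measure from below. Unbounded scales are thereby allowed. *)
Lemma vitali_bigcup : mu (\bigcup_n F n) <= C%:E * \int[mu]_(x in W) f x.
Proof.
pose U n := \bigcup_(i in [set` iota 0 n]) F i.
have mU n : measurable (U n) by exact: measurable_bigcup_seq.
have UF : \bigcup_n F n = \bigcup_n U n.
  apply/seteqP; split=> [x [n _ Fnx]|x [n _ [i _ Fix]]]; last by exists i.
  exists n.+1 => //; exists n => //.
  by apply: (_ : n \in iota 0 n.+1); rewrite mem_iota add0n ltnSn.
have ndU : {homo U : n m / (n <= m)%N >-> (n <= m)%O}.
  move=> n m nm; apply/subsetPset => x [i /= il Fix]; exists i => //=.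
  by move: il; rewrite !mem_iota !add0n /= => /leq_trans; exact.
have := @nondecreasing_cvg_mu _ _ _ mu U mU (bigcupT_measurable _ mU) ndU.
rewrite UF => cvU; rewrite -(cvg_lim _ cvU)//; apply: lime_le.
  by apply/cvg_ex; eexists; exact: cvU.
by apply: nearW => n; exact: (vitali_finite (leqnn _)).
Qed.

End vitali.

Section weak_type.
Context (R : realType) (mv mz : nat).
Local Notation N := ('rV[R]_mv * 'rV[R]_mz)%type.
Local Notation T := (N * R)%type.
Variables (A : set (set T)) (J : Type) (P : set J) (F E : J -> set T).
Variables (s : J -> R) (C : R).
Local Open Scope ereal_scope.
Hypothesis AF : forall B, A B -> B !=set0 -> exists2 j, P j & B = F j.
Hypothesis oF : forall j, P j -> open (F j).
Hypothesis mE : forall j, P j -> measurable (E j).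
Hypothesis FS : forall j, P j -> F j `<=` @S_domain R mv mz.
Hypothesis F_neq0 : forall j, P j -> F j !=set0.
Hypothesis engulf : forall i j, P i -> P j -> (s j <= s i)%R ->
  F i `&` F j !=set0 -> F j `<=` E i.
Hypothesis F_gt0 : forall j, P j -> 0 < S_haar (F j).
Hypothesis F_ltoo : forall j, P j -> S_haar (F j) < +oo.
Hypothesis C0 : (0 <= C)%R.
Hypothesis haar_E : forall j, P j -> S_haar (E j) <= C%:E * S_haar (F j).

(** The mean over [F j] exceeds [t], with the division cleared. Membership in [A] is recorded
    because [P] may index more sets than those of the family. *)
Let high (f : T -> R) (t : R) : set J := [set j | [/\ P j, A (F j) &
  t%:E * S_haar (F j) < \int[@S_haar R mv mz]_(y in F j) `|f y|%:E]].

Let average_gt (f : T -> R) (t : R) j : P j ->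
  (t%:E < (S_haar (F j))^-1 * \int[@S_haar R mv mz]_(y in F j) `|f y|%:E) =
  (t%:E * S_haar (F j) < \int[@S_haar R mv mz]_(y in F j) `|f y|%:E).
Proof.
move=> Pj; have := F_gt0 Pj; have := F_ltoo Pj.
case: (S_haar (F j)) => [r| |]// _; rewrite lte_fin => r0.
by rewrite inver gt_eqF// lte_pdivlMl// muleC.
Qed.

Let maximal_ge0 (f : T -> R) x : 0 <= maximal A f x.
Proof. by apply: ereal_sup_ubound; left. Qed.

(** As t >= 0, the value 0 put into the supremum cannot exceed t; the excess is witnessed by a set
    of the family, all of whose points share it. *)
Let maximal_gt (f : T -> R) (t : R) : (0 <= t)%R ->
  @S_domain R mv mz `&` [set x | t%:E < maximal A f x] =
  \bigcup_(j in high f t) F j.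
Proof.
move=> t0; apply/seteqP; split=> [x [Sx /= /ereal_sup_gt[y]]|x [j [Pj Aj hj]] Fx].
  case=> [->|[B [AB Bx] <-]]; first by rewrite lte_fin ltNge t0.
  have [|j Pj BF] := AF AB; first by exists x.
  rewrite BF average_gt// => h; exists j; last by rewrite -BF.
  by split=> //; rewrite -BF.
split; first exact: FS Fx.
rewrite /= (@lt_le_trans _ _ ((S_haar (F j))^-1 *
  \int[@S_haar R mv mz]_(y in F j) `|f y|%:E))//; first by rewrite average_gt.
by apply: ereal_sup_ubound; right; exists (F j).
Qed.

Let open_high (f : T -> R) (t : R) : open (\bigcup_(j in high f t) F j).
Proof. by apply: bigcup_open => j [Pj _ _]; exact: oF. Qed.

Let measurable_maximal (f : T -> R) :
  measurable_fun (@S_domain R mv mz) (maximal A f).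
Proof.
move=> mS; apply: (measurability _ (ErealGenOInfty.measurableE R)) => //.
move=> _ [_ [t ->] <-]; rewrite preimage_itvoy.
have [t0|t0] := leP 0%R t.
  by rewrite maximal_gt//; exact: open_measurable_T.
rewrite (_ : [set _ | _] = setT) ?setIT//; apply/seteqP; split=> // x _ /=.
by rewrite (lt_le_trans _ (maximal_ge0 f x))// lte_fin.
Qed.

(** On the selected sets rho(F j) is at most t^-1 times the integral of |f|, so the constant of
    [haar_E] becomes C / t in the covering lemma. *)
Let haar_maximal_gt (f : T -> R) (t : R) : (0 < t)%R ->
  measurable_fun (@S_domain R mv mz) (EFin \o f) ->
  S_haar (\bigcup_(j in high f t) F j) <=
  (C / t)%:E * \int[@S_haar R mv mz]_(x in @S_domain R mv mz) `|f x|%:E.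
Proof.
move=> t0 mf; have Ct0 : (0 <= C / t)%R by rewrite divr_ge0// ltW.
have [h0|hn] := eqVneq (high f t) set0.
  rewrite h0 bigcup_set0 measure0 mule_ge0//; exact: integral_ge0.
have [j|k [hk ->]] := @open_lindelof R mv mz J (high f t) F _ ((set0P _).1 hn).
  by case=> Pj _ _; exact: oF.
have Pk n : P (k n) by have [] := hk n.
apply: (@vitali_bigcup _ _ _ _ (@S_domain R mv mz) (F \o k) (E \o k) (s \o k)) => //.
- by move=> n; apply: open_measurable_T; exact: oF.
- by move=> n; exact: mE.
- exact: measurable_S_domain.
- by move=> n; exact: FS.
- by move=> n; exact: F_neq0.
- by move=> i j; exact: engulf.
- apply/measurable_EFinP; apply: (measurableT_comp (@normr_measurable R setT)).
  exact/measurable_EFinP.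
move=> n; have [_ _ hn'] := hk n; apply: (le_trans (haar_E (Pk n))).
rewrite EFinM -muleA lee_wpmul2l ?lee_fin//.
by rewrite lee_pdivlMl// ltW.
Qed.

Lemma bounded_L1_weak_L1_vitali : bounded_L1_weak_L1 (maximal A).
Proof.
exists C => f /integrableP[mf _]; split=> //.
apply: ge_ereal_sup => _ [t /= t0 <-].
under eq_set do rewrite gee0_abs//.
rewrite maximal_gt ?(ltW t0)//.
apply: (le_trans (lee_wpmul2l _ (haar_maximal_gt t0 mf))); first by rewrite lee_fin ltW.
by rewrite muleA -EFinM mulrCA divff ?gt_eqF// mulr1.
Qed.

End weak_type.

(** * Haar measure of products *)

Section haar_product.
Context (R : realType).
Local Open Scope ereal_scope.

(** By induction, since [rV_cons] pulls a sup-norm ball back to a product of balls. In dimension 0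
    the measure is a Dirac mass and the ball is everything. *)
Lemma lebesgue_rV_ball n (X : 'rV[R]_n) (u : R) : (0 < u)%R ->
  lebesgue_rV R n (ball X u) = ((u *+ 2) ^+ n)%:E.
Proof.
move=> u0; elim: n X => [|n IH] X.
  rewrite /= diracE mem_set ?expr0//.
  by apply/(ball_rV _ _ u0) => -[].
transitivity ((@lebesgue_measure R \x lebesgue_rV R n)
  (rV_cons (n:=n) @^-1` ball X u)); first by [].
rewrite (_ : rV_cons (n:=n) @^-1` ball X u = ball (X ord0 ord0) u `*`
    ball (\row_j X ord0 (lift ord0 j)) u); last first.
  apply/seteqP; split=> -[y Y] /=.
    move/(ball_rV _ _ u0) => H; split.
      by have := H ord0; rewrite mxE unlift_none.
    by apply/(ball_rV _ _ u0) => j; have := H (lift ord0 j); rewrite !mxE liftK.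
  case=> h /(ball_rV _ _ u0) H; apply/(ball_rV _ _ u0) => i; rewrite mxE.
  by case: (unliftP ord0 i) => [j ->|->//]; have := H j; rewrite !mxE.
rewrite product_measure1E; [|exact: measurable_ball|exact: measurable_ball_rV].
by rewrite [X in X * _](lebesgue_measure_ball _ (ltW u0)) IH -EFinM exprS.
Qed.

Lemma sigma_finite_product d1 d2 (T1 : measurableType d1) (T2 : measurableType d2)
  (m1 : {sigma_finite_measure set T1 -> \bar R})
  (m2 : {sigma_finite_measure set T2 -> \bar R}) : sigma_finite setT (m1 \x m2).
Proof.
have /sigma_finiteP[F [TF ndF Foo]] := sigma_finiteT m1.
have /sigma_finiteP[G [TG ndG Goo]] := sigma_finiteT m2.
exists (fun k => F k `*` G k).
  rewrite -setXTT TF TG predeqE => -[x y]; split.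
    move=> [/= [i _ Fix] [j _ Gjy]]; exists (maxn i j) => //; split.
    - by move: x Fix; exact/subsetPset/ndF/leq_maxl.
    - by move: y Gjy; exact/subsetPset/ndG/leq_maxr.
  by move=> [i _ []/= ? ?]; split; exists i.
move=> k; have [mF Fkoo] := Foo k; have [mG Gkoo] := Goo k.
split; first exact: measurableX.
by rewrite product_measure1E// lte_mul_pinfty// ge0_fin_numE.
Qed.

End haar_product.

HB.instance Definition _ (R : realType) (mv mz : nat) :=
  Measure_isSigmaFinite.Build _ _ _ (@N_haar R mv mz)
    (sigma_finite_product (lebesgue_rV R mv) (lebesgue_rV R mz)).

Section haar_log_itv.
Context (R : realType) (mv mz : nat).
Local Open Scope ereal_scope.

Definition log_itv (a l : R) : set R := `](a * expR (- l))%R, (a * expR l)%R[.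

Lemma integral_inv_log_itv (a l : R) : (0 < a)%R -> (0 < l)%R ->
  \int[@lebesgue_measure R]_(y in log_itv a l) (y^-1)%:E = (l *+ 2)%:E.
Proof.
move=> a0 l0.
set p := (a * expR (- l))%R; set q := (a * expR l)%R.
have p0 : (0 < p)%R by rewrite mulr_gt0// expR_gt0.
have q0 : (0 < q)%R by rewrite mulr_gt0// expR_gt0.
have pq : (p < q)%R by rewrite ltr_pM2l// ltr_expR; lra.
have cinv (y : R) : (p <= y)%R -> {for y, continuous (fun y : R => y^-1)%R}.
  move=> py; apply: inv_continuous; rewrite gt_eqF//; exact: lt_le_trans py.
have cW : {within `[p, q], continuous (fun y : R => y^-1)%R}.
  apply: continuous_in_subspaceT => y /set_mem/=; rewrite ?in_itv/= => /andP[py _].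
  exact: cinv.
(* The endpoints are added, since the fundamental theorem of calculus is applied on the closed
   interval. *)
have := @integral_itv_bndoo R p q (fun y => (y^-1)%:E) true false.
rewrite -/(log_itv a l) => <-; last first.
  apply/measurable_EFinP; apply: open_continuous_measurable_fun.
    exact: interval_open.
  by move=> y /set_mem/=; rewrite ?in_itv/= => /andP[py _]; exact/cinv/ltW.
rewrite (continuous_FTC2 pq cW (F := @ln R)).
- by rewrite !lnM ?posrE ?expR_gt0// !expRK -EFinB; congr EFin; ring.
- split=> [y||].
  + rewrite in_itv/= => /andP[py _]; apply: ex_derive.
    by apply: is_derive1_ln; exact: lt_trans py.
  + by apply: cvg_at_right_filter; exact: continuous_ln.
  + by apply: cvg_at_left_filter; exact: continuous_ln.
move=> y; rewrite in_itv/= => /andP[py _]; rewrite derive1E.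
by apply: derive_val; apply: is_derive1_ln; exact: lt_trans py.
Qed.

(** The density depends on the last variable only, so Tonelli's theorem factors the integral. *)
Lemma S_haar_log_itv (A : set ('rV[R]_mv * 'rV[R]_mz)) (a l : R) :
  measurable A -> (0 < a)%R -> (0 < l)%R ->
  S_haar (A `*` log_itv a l) = N_haar A * (l *+ 2)%:E.
Proof.
move=> mA a0 l0; rewrite /S_haar.
have mI : measurable (log_itv a l) by exact: measurable_itv.
have I0 y : log_itv a l y -> (0 < y)%R.
  rewrite /log_itv/= in_itv/= => /andP[h _]; apply: lt_trans h.
  by rewrite mulr_gt0// expR_gt0.
rewrite setIidl; last by move=> [n y] [_ /I0].
rewrite integral_mkcond.
set f := _ \_ _.
have f0 x : 0 <= f x.
  rewrite /f patchE; case: ifPn => // /[!inE] -[_ /I0 h].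
  by rewrite lee_fin invr_ge0 ltW.
have mf : measurable_fun setT f.
  apply/(measurable_restrictT _ _).1; first exact: measurableX.
  apply/measurable_EFinP.
  have minv : measurable_fun (log_itv a l) (fun a : R => a^-1%R).
    apply: open_continuous_measurable_fun; first exact: interval_open.
    move=> y; rewrite inE => /I0 y0.
    by apply: inv_continuous; rewrite gt_eqF.
  apply: (measurable_comp (F := log_itv a l) _ _ minv) => //.
    by move=> _ [x [_ h] <-].
  exact: (measurable_funTS (@measurable_snd _ _ _ R)).
rewrite (fubini_tonelli1 f mf f0) /fubini_F.
transitivity (\int[@N_haar R mv mz]_(x in A) (l *+ 2)%:E); last first.
  by rewrite integral_cst// muleC.
rewrite [RHS]integral_mkcond; apply: eq_integral => x _.
rewrite patchE; case: ifPn => xA; rewrite inE in xA || rewrite notin_setE in xA.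
  rewrite -(integral_inv_log_itv a0 l0) [RHS]integral_mkcond.
  apply: eq_integral => y _; rewrite /f !patchE; congr (if _ then _ else _).
  by apply/idP/idP; rewrite !inE => // -[].
rewrite [LHS](_ : _ = 0)//; apply: integral0_eq => y _.
by rewrite /f patchE ifF//; apply/negP; rewrite inE => -[].
Qed.

End haar_log_itv.

(** * Boxes of N *)

Section N_boxes.
Context (R : realType) (mv mz : nat).
Local Notation V := 'rV[R]_mv.
Local Notation Z := 'rV[R]_mz.
Local Notation N := (V * Z)%type.
Variable br : {bilinear V -> V -> Z}.

Lemma bilinear_bounded :
  exists2 K : R, 0 <= K & forall X Y, `|br X Y| <= K * `|X| * `|Y|.
Proof.
pose e i : V := delta_mx 0 i.
exists (\sum_i \sum_j `|br (e i) (e j)|) => [|X Y].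
  by apply: sumr_ge0 => i _; apply: sumr_ge0.
rewrite {1}[X]row_sum_delta linear_sumlz -mulrA mulr_suml.
apply: (le_trans (ler_norm_sum _ _ _)); apply: ler_sum => i _.
rewrite {1}[Y]row_sum_delta linear_sumr mulr_suml.
apply: (le_trans (ler_norm_sum _ _ _)); apply: ler_sum => j _.
rewrite linearZl_LR linearZr_LR !normrZ mulrA [leRHS]mulrC ler_wpM2r//.
by rewrite ler_pM// ler_norm_rV.
Qed.

(* The v- and z-components of n^-1 n' are n'.1 - n.1 and [N_diff n n'].       *)
Definition N_diff (n n' : N) : Z := n'.2 - n.2 - 2^-1 *: br n.1 n'.1.

(** The left translate by [n] of a product of sup-norm balls centred at 0. *)
Definition N_box (n : N) (u v : R) : set N :=
  [set n' | `|n'.1 - n.1| < u /\ `|N_diff n n'| < v].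

Lemma N_box_le n u v u' v' : u <= u' -> v <= v' -> N_box n u v `<=` N_box n u' v'.
Proof. by move=> uu' vv' p [h1 h2]; split; [apply: lt_le_trans uu'|apply: lt_le_trans vv']. Qed.

Hypothesis brXX : forall X, br X X = 0.

Lemma br_anti X Y : br X Y = - br Y X.
Proof.
have := brXX (X + Y); rewrite linearDl !linearDr !brXX addr0 add0r => /eqP.
by rewrite addr_eq0 => /eqP.
Qed.

Lemma N_diff_refl n : N_diff n n = 0.
Proof. by rewrite /N_diff subrr brXX scaler0 subrr. Qed.

(** The z-component of n^-1 p = (n^-1 m)(m^-1 p). *)
Lemma N_diff_trans n m p : N_diff n p =
  N_diff n m + N_diff m p + 2^-1 *: br (m.1 - n.1) (p.1 - m.1).
Proof.
rewrite /N_diff linearBl !linearBr brXX.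
by apply/rowP => i; rewrite !mxE; lra.
Qed.

Lemma N_diff_sym n m : N_diff m n = - N_diff n m.
Proof.
rewrite /N_diff [br m.1 _]br_anti.
by apply/rowP => i; rewrite !mxE; lra.
Qed.

Lemma N_box_refl n u v : 0 < u -> 0 < v -> N_box n u v n.
Proof. by move=> u0 v0; split; rewrite ?subrr ?N_diff_refl normr0. Qed.

Lemma N_box_sym n u v m : N_box n u v m -> N_box m u v n.
Proof. by case=> h1 h2; split; [rewrite distrC|rewrite N_diff_sym normrN]. Qed.

Variable K : R.
Hypothesis K0 : 0 <= K.
Hypothesis brK : forall X Y, `|br X Y| <= K * `|X| * `|Y|.

Lemma N_diff_trans_le n m p : `|N_diff n p| <=
  `|N_diff n m| + `|N_diff m p| + K * `|m.1 - n.1| * `|p.1 - m.1|.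
Proof.
rewrite (N_diff_trans n m p); apply: (le_trans (ler_normD _ _)).
apply: lerD; first exact: ler_normD.
rewrite normrZ gtr0_norm ?invr_gt0//.
have := brK (m.1 - n.1) (p.1 - m.1); have := normr_ge0 (br (m.1 - n.1) (p.1 - m.1)).
by lra.
Qed.

Lemma N_box_trans n m p a b c d : N_box n a b m -> N_box m c d p ->
  N_box n (a + c) (b + d + K * a * c) p.
Proof.
move=> [h1 h2] [h3 h4]; split.
  rewrite (_ : p.1 - n.1 = (m.1 - n.1) + (p.1 - m.1)); last by rewrite [RHS]addrC subrKA.
  exact: le_lt_trans (ler_normD _ _) (ltrD h1 h3).
apply: (le_lt_trans (N_diff_trans_le n m p)); apply: ltr_leD; first exact: ltrD.
rewrite -!mulrA ler_wpM2l//; apply: ler_pM => //; exact: ltW.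
Qed.

(** Go from n to a common point, then to n', then to q; the last two steps have sizes u' and v'. The
    brackets created by the two products contribute at most K u'^2 and 2 K u u'. *)
Lemma N_box_engulf n u v n' u' v' C : 0 <= u -> 0 <= u' ->
  u' <= C * u -> v' <= C * v -> N_box n u v `&` N_box n' u' v' !=set0 ->
  N_box n' u' v' `<=` N_box n ((1 + 2 * C) * u)
    ((1 + 2 * C) * v + K * (C ^+ 2 + 2 * C) * u ^+ 2).
Proof.
move=> u0 u'0 uC vC [p [pn pn']] q qn'.
have := N_box_trans pn (N_box_trans (N_box_sym pn') qn').
apply: N_box_le; first lra.
have h1 : K * u' * u' <= K * (C ^+ 2 * u ^+ 2).
  by rewrite -mulrA ler_wpM2l// -exprMn -expr2 lerXn2r// nnegrE// (le_trans u'0).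
have h2 : K * u * (u' + u') <= K * (2 * C * u ^+ 2).
  rewrite -mulrA ler_wpM2l// expr2 mulrA [leRHS]mulrC ler_wpM2l//; lra.
have -> : K * (C ^+ 2 + 2 * C) * u ^+ 2 = K * (C ^+ 2 * u ^+ 2) + K * (2 * C * u ^+ 2) by ring.
by lra.
Qed.

Lemma continuous_br X : continuous (br X).
Proof.
move=> Y A /nbhs_ballP[e /= e0 eA]; apply/nbhs_ballP.
have X1 : 0 < K * `|X| + 1 by rewrite ltr_wpDl// mulr_ge0.
exists (e / (K * `|X| + 1)) => /=; first by rewrite divr_gt0.
move=> Y'; rewrite -ball_normE/= ltr_pdivlMr// mulrC => h; apply: eA.
rewrite -ball_normE/= -linearBr; apply: (le_lt_trans (brK _ _)).
by apply: le_lt_trans h; rewrite ler_wpM2r//; lra.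
Qed.

Lemma continuous_N_diff n : continuous (N_diff n).
Proof.
move=> m; apply: cvgB; first by apply: cvgB; [exact: cvg_snd|exact: cvg_cst].
apply: cvgZr; apply: (@continuous_comp _ _ _ fst (br n.1)); first exact: cvg_fst.
exact: continuous_br.
Qed.

Lemma open_norm_lt (T : topologicalType) (W : normedModType R) (f : T -> W) (c : R) :
  continuous f -> open [set x | `|f x| < c].
Proof.
move=> cf; apply: (@open_comp _ _ (fun x => `|f x|) [set y | y < c]) => [x _|].
  by apply: cvg_norm; exact: cf.
exact: open_lt.
Qed.

Lemma open_N_box n u v : open (N_box n u v).
Proof.
apply: openI; apply: open_norm_lt; last exact: continuous_N_diff.
by move=> m; apply: cvgB; [exact: cvg_fst|exact: cvg_cst].
Qed.

End N_boxes.

Section boxes.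
Context (R : realType) (mv mz : nat).
Local Notation V := 'rV[R]_mv.
Local Notation Z := 'rV[R]_mz.
Local Notation N := (V * Z)%type.
Local Notation T := (N * R)%type.
Variable br : {bilinear V -> V -> Z}.
Hypothesis brXX : forall X, br X X = 0.
Variable K : R.
Hypothesis K0 : 0 <= K.
Hypothesis brK : forall X Y, `|br X Y| <= K * `|X| * `|Y|.

(** The product of the box with R is open in [T], hence measurable, and the box is a slice of it. *)
Lemma measurable_N_box n u v : measurable (N_box br n u v).
Proof.
have oN := @open_N_box R mv mz br K K0 brK n u v.
have : measurable ((N_box br n u v `*` [set: R]) : set T).
  apply: open_measurable_T; rewrite (_ : _ `*` _ = fst @^-1` N_box br n u v).
    by apply: open_comp => // x _; exact: cvg_fst.
  by apply/seteqP; split=> [x []|x h]//=; split.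
move=> m; rewrite (_ : N_box br n u v = (fun p : N => (p, 0 : R)) @^-1`
   (N_box br n u v `*` [set: R])); last by apply/seteqP; split=> p //= -[].
rewrite -[X in measurable X]setTI.
by apply: (measurable_fun_pair (@measurable_id _ N setT) (measurable_cst (0 : R))).
Qed.

(** The slice over X is a ball centred at n.2 + [n.1, X] / 2: the bracket shifts it without changing
    its measure. *)
Lemma N_haar_box n u v : 0 < u -> 0 < v ->
  N_haar (N_box br n u v) = ((u *+ 2) ^+ mv * (v *+ 2) ^+ mz)%:E.
Proof.
move=> u0 v0; rewrite /N_haar/= /product_measure1.
transitivity (\int[lebesgue_rV R mv]_(X in ball n.1 u) ((v *+ 2) ^+ mz)%:E)%E; last first.
  rewrite integral_cst; last exact: measurable_ball_rV.
  by rewrite [X in (_ * X)%E](lebesgue_rV_ball _ u0) -EFinM mulrC.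
rewrite [RHS]integral_mkcond; apply: eq_integral => X _; rewrite patchE /=.
case: ifPn => [|/negP] /[!inE] h.
  rewrite -(lebesgue_rV_ball (n.2 + 2^-1 *: br n.1 X) v0); congr (lebesgue_rV R mz _).
  apply/seteqP; split=> Y; rewrite /xsection/= inE -!ball_normE/= /N_box/= /N_diff/=.
    by case=> _; rewrite -addrA -opprD distrC.
  move=> h2; split; last by rewrite -addrA -opprD distrC.
  by move: h; rewrite -ball_normE/= distrC.
rewrite (_ : xsection _ _ = set0) ?measure0//; apply/seteqP; split=> // Y.
rewrite /xsection/= inE => -[h' _]; apply: h; rewrite -ball_normE/=.
by rewrite distrC.
Qed.

Lemma S_haar_box n u v a l : 0 < u -> 0 < v -> 0 < a -> 0 < l ->
  S_haar (N_box br n u v `*` log_itv a l) =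
  ((u *+ 2) ^+ mv * (v *+ 2) ^+ mz * (l *+ 2))%:E.
Proof.
move=> u0 v0 a0 l0.
by rewrite S_haar_log_itv ?N_haar_box//; exact: measurable_N_box.
Qed.

Lemma log_itvP (a l y : R) : 0 < a -> log_itv a l y <-> 0 < y /\ `|ln y - ln a| < l.
Proof.
move=> a0; rewrite /log_itv/= in_itv/=; split=> [/andP[h1 h2]|[y0]].
  have y0 : 0 < y by apply: lt_trans h1; rewrite mulr_gt0// expR_gt0.
  split=> //; move: h1 h2.
  rewrite -[y]lnK ?posrE// -[a]lnK ?posrE// !expRK -!expRD !ltr_expR => h1 h2.
  by rewrite ltr_norml; lra.
rewrite ltr_norml => /andP[h1 h2].
rewrite -[y]lnK ?posrE// -[a]lnK ?posrE// -!expRD !ltr_expR.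
by apply/andP; split; lra.
Qed.

(** The triangle inequality for |ln y - ln a|. *)
Lemma log_itv_engulf (a l a' l' : R) : 0 < a -> 0 < a' ->
  log_itv a l `&` log_itv a' l' !=set0 ->
  log_itv a' l' `<=` log_itv a (l + 2 * l').
Proof.
move=> a0 a'0 [p [/(log_itvP _ _ a0)[p0 h1] /(log_itvP _ _ a'0)[_ h2]]].
move=> q /(log_itvP _ _ a'0)[q0 h3]; apply/(log_itvP _ _ a0); split=> //.
move: h1 h2 h3; rewrite !ltr_norml; lra.
Qed.

Lemma log_itv_le (a l l' : R) : 0 < a -> l <= l' -> log_itv a l `<=` log_itv a l'.
Proof.
move=> a0 ll' y /(log_itvP _ _ a0)[y0 h]; apply/(log_itvP _ _ a0); split=> //.
exact: lt_le_trans ll'.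
Qed.

Lemma log_itv_gt0 (a l y : R) : 0 < a -> log_itv a l y -> 0 < y.
Proof. by move=> a0 /(log_itvP _ _ a0)[]. Qed.

Lemma log_itv_refl (a l : R) : 0 < a -> 0 < l -> log_itv a l a.
Proof. by move=> a0 l0; apply/(log_itvP _ _ a0); rewrite subrr normr0. Qed.

Section box_family.
Variables (A : set (set T)) (J : Type) (P : set J) (F : J -> set T).
Variables (n : J -> N) (a l u v s : J -> R) (c C K1 : R).
Hypothesis AF : forall B, A B -> B !=set0 -> exists2 j, P j & B = F j.
Hypothesis oF : forall j, P j -> open (F j).
Hypothesis c_gt0 : 0 < c.
Hypothesis C_ge0 : 0 <= C.
Hypothesis K1_ge0 : 0 <= K1.
Hypothesis pos : forall j, P j -> [/\ 0 < a j, 0 < l j, 0 < u j & 0 < v j].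
Hypothesis uv : forall j, P j -> u j ^+ 2 <= K1 * v j.
Hypothesis F_inner : forall j, P j ->
  N_box br (n j) (c * u j) (c * v j) `*` log_itv (a j) (c * l j) `<=` F j.
Hypothesis F_outer : forall j, P j ->
  F j `<=` N_box br (n j) (u j) (v j) `*` log_itv (a j) (l j).
Hypothesis scale : forall i j, P i -> P j -> s j <= s i ->
  log_itv (a i) (l i) `&` log_itv (a j) (l j) !=set0 ->
  [/\ u j <= C * u i, v j <= C * v i & l j <= C * l i].

Let C1 := 1 + 2 * C.
(** The last term is the quadratic error of [N_box_engulf], turned into a multiple of v by u^2 <= K1
    v. *)
Let C2 := 1 + 2 * C + K * (C ^+ 2 + 2 * C) * K1.
Let E j : set T := N_box br (n j) (C1 * u j) (C2 * v j) `*`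
  log_itv (a j) (C1 * l j).
(** The ratio of the measures of [E j] and of the inner product, the same for all [j]. *)
Let M := (C1 / c) ^+ mv * (C2 / c) ^+ mz * (C1 / c).

Let C1_gt0 : 0 < C1. Proof. by rewrite /C1 ltr_pwDl// mulr_ge0. Qed.

Let C2_gt0 : 0 < C2.
Proof.
rewrite /C2; apply: (lt_le_trans C1_gt0); rewrite lerDl.
by rewrite !mulr_ge0// addr_ge0 ?sqr_ge0 ?mulr_ge0.
Qed.

Let inner_gt0 j : P j -> (0 < S_haar (N_box br (n j) (c * u j) (c * v j) `*`
  log_itv (a j) (c * l j)))%E.
Proof.
move=> /pos[a0 l0 u0 v0]; rewrite S_haar_box ?mulr_gt0// lte_fin.
by rewrite !mulr_gt0// ?exprn_gt0// pmulrn_lgt0// mulr_gt0.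
Qed.

Let measurable_box_prod p x y b m :
  measurable (N_box br p x y `*` log_itv b m : set T).
Proof. by apply: measurableX; [exact: measurable_N_box|exact: measurable_itv]. Qed.

Let inner_le j : P j -> (S_haar (N_box br (n j) (c * u j) (c * v j) `*`
  log_itv (a j) (c * l j)) <= S_haar (F j))%E.
Proof.
move=> Pj; apply: le_measure; rewrite ?inE//; last exact: F_inner.
by apply: open_measurable_T; exact: oF.
Qed.

(** Engulfing is checked on the outer products, while the inner ones bound the measure of [F j] from
    below. *)
Lemma bounded_L1_weak_L1_box_family : bounded_L1_weak_L1 (maximal A).
Proof.
have M0 : 0 <= M.
  have C1c : 0 <= C1 / c by apply: divr_ge0; exact: ltW.
  have C2c : 0 <= C2 / c by apply: divr_ge0; exact: ltW.
  by rewrite /M mulr_ge0// mulr_ge0// exprn_ge0.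
apply: (@bounded_L1_weak_L1_vitali R mv mz A J P F E s M AF oF) => //.
- by move=> j Pj; exact: measurable_box_prod.
- by move=> j Pj x /(F_outer Pj)[_]; apply: log_itv_gt0; have [] := pos Pj.
- move=> j Pj; have [a0 l0 u0 v0] := pos Pj; exists (n j, a j).
  apply: (F_inner Pj); split=> /=; first by apply: N_box_refl => //; exact: mulr_gt0.
  by apply: log_itv_refl => //; exact: mulr_gt0.
- move=> i j Pi Pj sij [x [/(F_outer Pi)[Nx ax] /(F_outer Pj)[Nx' ax']]].
  have [|uC vC lC] := scale Pi Pj sij; first by exists x.2.
  have [ai li ui vi] := pos Pi; have [aj lj uj vj] := pos Pj.
  move=> y /(F_outer Pj)[Ny ay]; split.
    have := @N_box_engulf R mv mz br brXX K K0 brK _ _ _ _ _ _ C (ltW ui) (ltW uj) uC vC.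
    move=> /(_ _ _ (ex_intro _ _ (conj Nx Nx')) _ Ny); apply: N_box_le => //.
    rewrite /C2 [leRHS]mulrDl lerD2l -[leRHS]mulrA ler_wpM2l//; last exact: uv.
    by rewrite mulr_ge0// addr_ge0 ?sqr_ge0 ?mulr_ge0.
  have := log_itv_engulf ai aj (ex_intro _ _ (conj ax ax')) ay.
  by apply: log_itv_le => //; rewrite /C1; lra.
- by move=> j Pj; apply: lt_le_trans (inner_gt0 Pj) (inner_le Pj).
- move=> j Pj; have [a0 l0 u0 v0] := pos Pj.
  apply: (@le_lt_trans _ _ (S_haar (N_box br (n j) (u j) (v j) `*` log_itv (a j) (l j)))).
    apply: le_measure; rewrite ?inE//; last exact: F_outer.
    by apply: open_measurable_T; exact: oF.
  by rewrite S_haar_box// ltry.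
- move=> j Pj; have [a0 l0 u0 v0] := pos Pj.
  apply: le_trans (lee_wpmul2l _ (inner_le Pj)); last by rewrite lee_fin.
  rewrite !S_haar_box ?mulr_gt0// -EFinM lee_fin le_eqVlt; apply/orP; left; apply/eqP.
  rewrite /M !(mulrnAr, exprMn, mulrnAl) -!mulrnAr !exprMn !exprVn.
  by field; rewrite !expf_neq0 !gt_eqF.
Qed.

End box_family.
End boxes.

Section enorm_theory.
Context (R : realType).

Lemma enorm_ge0 n (X : 'rV[R]_n) : 0 <= enorm X.
Proof. exact: sqrtr_ge0. Qed.

Lemma sqr_enorm n (X : 'rV[R]_n) : enorm X ^+ 2 = \sum_(i < n) X ord0 i ^+ 2.
Proof. by rewrite sqr_sqrtr// sumr_ge0// => i _; exact: sqr_ge0. Qed.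

Lemma enormZ n (X : 'rV[R]_n) c : 0 <= c -> enorm (c *: X) = c * enorm X.
Proof.
move=> c0; rewrite /enorm; under eq_bigr do rewrite mxE exprMn.
by rewrite -mulr_sumr sqrtrM ?sqr_ge0// sqrtr_sqr ger0_norm.
Qed.

Lemma norm_le_enorm n (X : 'rV[R]_n) : `|X| <= enorm X.
Proof.
apply/norm_rV_le => [|i]; first exact: enorm_ge0.
rewrite -sqrtr_sqr ler_wsqrtr// (bigD1 i)//= lerDl.
by apply: sumr_ge0 => j _; exact: sqr_ge0.
Qed.

(** A crude constant in place of the square root of n; it is positive even for n = 0, so one may
    divide by it. *)
Lemma enorm_le_norm n (X : 'rV[R]_n) : enorm X <= n.+1%:R * `|X|.
Proof.
rewrite -[leRHS]ger0_norm ?mulr_ge0// -sqrtr_sqr ler_wsqrtr// exprMn.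
apply: (@le_trans _ _ (\sum_(i < n) `|X| ^+ 2)).
  apply: ler_sum => i _; rewrite -[leLHS]ger0_norm ?sqr_ge0// normrX.
  by rewrite lerXn2r// ?nnegrE// ler_norm_rV.
rewrite sumr_const card_ord -[leLHS]mulr_natl ler_wpM2r ?sqr_ge0// -natrX ler_nat.
by rewrite (leq_trans (leqnSn n))// -mulnn leq_pmulr.
Qed.

End enorm_theory.

(** * Balls of N and big sets *)

Section N_balls.
Context (R : realType) (mv mz : nat).
Local Notation V := 'rV[R]_mv.
Local Notation Z := 'rV[R]_mz.
Local Notation N := (V * Z)%type.
Local Notation T := (N * R)%type.
Variable br : {bilinear V -> V -> Z}.
Hypothesis brXX : forall X, br X X = 0.

Lemma N_norm_lt (p : N) r : 0 < r ->
  (N_norm p < r) = (enorm p.1 ^+ 4 / 16 + enorm p.2 ^+ 2 < r ^+ 4).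
Proof.
move=> r0; rewrite /N_norm; set x := _ + _.
have x0 : 0 <= x by rewrite addr_ge0 ?divr_ge0 ?exprn_ge0 ?enorm_ge0.
rewrite -(@ltr_pXn2r _ 4)// ?nnegrE ?powR_ge0 ?(ltW r0)//.
by rewrite -powR_mulrn ?powR_ge0// -powRrM mulVf ?powRr1// pnatr_eq0.
Qed.

Lemma N_dist_diff (n n' : N) : N_dist br n n' = N_norm (n'.1 - n.1, N_diff br n n').
Proof.
rewrite /N_dist /N_mul /N_inv /N_diff/= linearNl scalerN.
by rewrite [- n.1 + _]addrC [- n.2 + _]addrC.
Qed.

(** Each of the two summands |X|^4 / 16 and |Z|^2 is less than r^4. *)
Lemma N_ball_box n r : 0 < r -> N_ball br n r `<=` N_box br n (2 * r) (r ^+ 2).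
Proof.
move=> r0 p; rewrite /N_ball/= N_dist_diff N_norm_lt//= => h.
have e1 := exprn_ge0 4 (enorm_ge0 (p.1 - n.1)).
have e2 := sqr_ge0 (enorm (N_diff br n p)).
split; apply: le_lt_trans (norm_le_enorm _) _.
  rewrite -(@ltr_pXn2r _ 4)// ?nnegrE ?enorm_ge0//; last by lra.
  rewrite exprMn; lra.
rewrite -(@ltr_pXn2r _ 2)// ?nnegrE ?enorm_ge0 ?sqr_ge0// -exprM; lra.
Qed.

(** This [c] makes the Euclidean norms smaller than r / 2 and r^2 / 2, and (r / 2)^4 / 16 + (r^2 /
    2)^2 < r^4. *)
Lemma N_box_ball n r : 0 < r -> let c := (2 * (mv + mz).+1%:R)^-1 in
  N_box br n (c * r) (c * r ^+ 2) `<=` N_ball br n r.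
Proof.
move=> r0 c p [h1 h2]; rewrite /N_ball/= N_dist_diff N_norm_lt//=.
have m0 : 0 < (mv + mz).+1%:R :> R by rewrite ltr0n.
have bound k (X : 'rV[R]_k) x : (k <= mv + mz)%N -> `|X| < c * x -> enorm X < x / 2.
  move=> km Xx; apply: (le_lt_trans (enorm_le_norm X)).
  apply: (@le_lt_trans _ _ ((mv + mz).+1%:R * `|X|)).
    by rewrite ler_wpM2r// ler_nat ltnS.
  rewrite -ltr_pdivlMl//; apply: (lt_le_trans Xx); rewrite /c invfM.
  by rewrite le_eqVlt; apply/orP; left; apply/eqP; ring.
have := bound _ _ _ (leq_addr _ _) h1; have := bound _ _ _ (leq_addl _ _) h2.
have := enorm_ge0 (p.1 - n.1); have := enorm_ge0 (N_diff br n p).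
move: (enorm (N_diff br n p)) (enorm (p.1 - n.1)) => y x y0 x0 hy hx.
have hx4 : x ^+ 4 < r ^+ 4 / 16.
  rewrite (_ : r ^+ 4 / 16 = (r / 2) ^+ 4); last by field.
  by rewrite ltr_pXn2r// nnegrE divr_ge0 // ltW.
have hy2 : y ^+ 2 < r ^+ 4 / 4.
  rewrite (_ : r ^+ 4 / 4 = (r ^+ 2 / 2) ^+ 2); last by field.
  by rewrite ltr_pXn2r ?nnegrE ?divr_ge0 ?sqr_ge0.
have : 0 < r ^+ 4 by rewrite exprn_gt0.
lra.
Qed.

Variable K : R.
Hypothesis K0 : 0 <= K.
Hypothesis brK : forall X Y, `|br X Y| <= K * `|X| * `|Y|.

Lemma continuous_sqr_enorm (T' : topologicalType) k (f : T' -> 'rV[R]_k) :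
  continuous f -> continuous (fun x => enorm (f x) ^+ 2).
Proof.
move=> cf; under eq_fun do rewrite sqr_enorm.
apply: continuous_big => [|i _]; first exact: add_continuous.
move=> x; have ci : (f y ord0 i) @[y --> x] --> f x ord0 i.
  by apply: (@continuous_comp _ _ _ f (fun X => X ord0 i)); [exact: cf|exact: coord_continuous].
exact: (cvgM ci ci).
Qed.

Lemma open_N_ball n r : 0 < r -> open (N_ball br n r).
Proof.
move=> r0; rewrite (_ : N_ball br n r = (fun p : N =>
    (enorm (p.1 - n.1) ^+ 2) ^+ 2 / 16 + enorm (N_diff br n p) ^+ 2) @^-1`
    [set y | y < r ^+ 4]); last first.
  by apply/seteqP; split=> p; rewrite /N_ball/= N_dist_diff N_norm_lt// -exprM.
apply: open_comp; last exact: open_lt.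
move=> p _; apply: cvgD.
  apply: cvgMr_tmp; rewrite expr2.
  have c1 := @continuous_sqr_enorm N _ (fun p : N => p.1 - n.1).
  by apply: cvgM; apply: c1 => m; apply: cvgB;
    [exact: cvg_fst|exact: cvg_cst|exact: cvg_fst|exact: cvg_cst].
have c2 := @continuous_sqr_enorm N _ (N_diff br n).
by apply: c2; exact: (continuous_N_diff K0 brK).
Qed.

(** The condition on [ln s] reads a^1/2 e^(b1 l) <= s <= a^1/2 e^(b2 l). It ties the length of the
    interval to [s], so that [s] alone can serve as the scale. *)
Lemma bounded_L1_weak_L1_big_sets (A : set (set T)) (b1 b2 c1 c2 : R) :
  2^-1 < b1 -> 0 < b2 -> 0 < c1 -> 0 < c2 ->
  (forall B, A B -> B !=set0 -> exists n a l s G,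
    [/\ [/\ 0 < a, 0 < l, 0 < s & open G],
        ln a / 2 + b1 * l <= ln s <= ln a / 2 + b2 * l,
        N_ball br n (c1 * s) `<=` G, G `<=` N_ball br n (c2 * s) &
        B = G `*` log_itv a l]) ->
  bounded_L1_weak_L1 (maximal A).
Proof.
move=> b1_gt b2_gt c1_gt c2_gt AF.
pose P (j : N * R * R * R * set N) :=
  let: (n, a, l, s, G) := j in
  [/\ [/\ 0 < a, 0 < l, 0 < s & open G],
        ln a / 2 + b1 * l <= ln s <= ln a / 2 + b2 * l,
        N_ball br n (c1 * s) `<=` G & G `<=` N_ball br n (c2 * s)].
pose F (j : N * R * R * R * set N) : set T := j.2 `*` log_itv j.1.1.1.2 j.1.1.2.
pose c0 : R := (2 * (mv + mz).+1%:R)^-1.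
have c0_gt : 0 < c0 by rewrite invr_gt0 mulr_gt0// ltr0n.
(* The three terms serve the interval, the v-size and the z-size of the inner box, which
   [N_box_ball] places in the ball of radius c1 s. *)
pose c := Num.min 1 (Num.min (c0 * c1 / (2 * c2)) (c0 * c1 ^+ 2 / c2 ^+ 2)).
pose C := 1 + (b2 + 2^-1) / (b1 - 2^-1).
have C1 : 1 <= C by rewrite lerDl divr_ge0; lra.
(* The outer sizes are those of [N_ball_box] for the radius c2 s, whence K1 = 4. *)
apply: (@bounded_L1_weak_L1_box_family R mv mz br brXX K K0 brK A _ P F
  (fun j => j.1.1.1.1) (fun j => j.1.1.1.2) (fun j => j.1.1.2)
  (fun j => 2 * (c2 * j.1.2)) (fun j => (c2 * j.1.2) ^+ 2) (fun j => j.1.2) c C 4) => //.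
- move=> B AB /(AF _ AB)[n [a [l [s [G [h1 h2 h3 h4 ->]]]]]].
  by exists (n, a, l, s, G).
- move=> [[[[n a] l] s] G] [[a0 l0 s0 oG] _ _ _].
  rewrite /F/= (_ : _ `*` _ = (fst @^-1` G) `&` (snd @^-1` log_itv a l))//.
  apply: openI; apply: open_comp => //.
  + by move=> x _; exact: cvg_fst.
  + by move=> x _; exact: cvg_snd.
- rewrite /c !lt_min ltr01 !divr_gt0 ?mulr_gt0 ?exprn_gt0//.
- lra.
- move=> [[[[n a] l] s] G] [[a0 l0 s0 oG] _ _ _] /=.
  by rewrite !mulr_gt0 ?exprn_gt0 ?mulr_gt0.
- move=> [[[[n a] l] s] G] _ /=; rewrite le_eqVlt; apply/orP; left; apply/eqP.
  by ring.
- move=> [[[[n a] l] s] G] [[a0 l0 s0 oG] _ h _] x /= [Nx lx]; split => /=.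
    apply/h/N_box_ball; first exact: mulr_gt0.
    apply: N_box_le Nx.
      have : c <= c0 * c1 / (2 * c2) by rewrite /c !ge_min lexx !orbT.
      rewrite ler_pdivlMr ?mulr_gt0// => hc.
      by rewrite !mulrA ler_pM2r// -mulrA.
    have : c <= c0 * c1 ^+ 2 / c2 ^+ 2 by rewrite /c !ge_min lexx !orbT.
    rewrite ler_pdivlMr ?exprn_gt0// => hc.
    by rewrite !exprMn [leLHS]mulrA [leRHS]mulrA ler_pM2r ?exprn_gt0.
  by apply: log_itv_le lx => //; rewrite ler_piMl ?(ltW l0)// /c ge_min lexx.
- move=> [[[[n a] l] s] G] [[a0 l0 s0 oG] _ _ h] x /= [Nx lx]; split => //=.
  by apply: N_ball_box; [exact: mulr_gt0|exact: h].
move=> [[[[n a] l] s] G] [[[[n' a'] l'] s'] G'] [[a0 l0 s0 oG] /andP[_ h1] _ _]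
  [[a'0 l'0 s'0 oG'] /andP[h2 _] _ _] /= ss'.
case=> y [/(log_itvP _ _ a0)[_ hy] /(log_itvP _ _ a'0)[_ hy']].
have cs : c2 * s' <= c2 * s by rewrite ler_pM2l.
have cs0 : 0 < c2 * s by rewrite mulr_gt0.
have cs'0 : 0 < c2 * s' by rewrite mulr_gt0.
split.
- by rewrite (@le_trans _ _ (2 * (c2 * s)))// ?ler_pM2l// ler_peMl// mulr_ge0// ltW.
- rewrite (@le_trans _ _ ((c2 * s) ^+ 2))// ?ler_peMl ?sqr_ge0//.
  by rewrite lerXn2r// nnegrE ltW.
have lns : ln s' <= ln s by rewrite ler_ln.
(* As the intervals meet, |ln a - ln a'| < l + l', hence b1 l' <= ln s' - ln a' / 2 <= ln s - ln a'
   / 2 <= b2 l + (l + l') / 2. Since b1 > 1/2, the l' on the right is absorbed. *)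
have : (b1 - 2^-1) * l' <= (b2 + 2^-1) * l.
  by move: hy hy'; rewrite !ltr_norml; lra.
rewrite -ler_pdivlMl; last by lra.
move=> h; apply: (le_trans h); rewrite mulrA ler_pM2r// [leLHS]mulrC /C; lra.
Qed.

End N_balls.

Section big_families.
Context (R : realType) (mv mz : nat).
Local Notation V := 'rV[R]_mv.
Local Notation Z := 'rV[R]_mz.
Local Notation N := (V * Z)%type.
Local Notation T := (N * R)%type.
Variable br : {bilinear V -> V -> Z}.
Hypothesis brXX : forall X, br X X = 0.
Variable K : R.
Hypothesis K0 : 0 <= K.
Hypothesis brK : forall X Y, `|br X Y| <= K * `|X| * `|Y|.

Lemma itv_inv_log_itv (a r : R) : 0 < r -> `]a / r, a * r[%classic = log_itv a (ln r).
Proof. by move=> r0; rewrite /log_itv expRN lnK ?posrE. Qed.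

Lemma ln_sqrt (a : R) : 0 < a -> ln (Num.sqrt a) = ln a / 2.
Proof. by move=> a0; rewrite -powR12_sqrt ?ltW// ln_powR mulrC. Qed.

(** On the N-component, left translation by x is a dilation followed by left translation by [x.1],
    which preserves [N_dist]. *)
Lemma N_dist_translate (x y : T) : 0 < x.2 ->
  N_dist br x.1 (S_mul br x y).1 =
  N_norm (Num.sqrt x.2 *: y.1.1, x.2 *: y.1.2).
Proof.
move=> x0; rewrite N_dist_diff /S_mul /N_diff/=; congr (N_norm (_, _)).
  by rewrite addrAC subrr add0r.
rewrite linearDr brXX add0r linearZr_LR.
by apply/rowP => i; rewrite !mxE; lra.
Qed.

Lemma N_norm_dilate (p : N) a r : 0 < a -> 0 < r ->
  (N_norm (Num.sqrt a *: p.1, a *: p.2) < Num.sqrt a * r) = (N_norm p < r).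
Proof.
move=> a0 r0; have sa0 : 0 < Num.sqrt a by rewrite sqrtr_gt0.
rewrite !N_norm_lt ?mulr_gt0//= !enormZ ?ltW// !exprMn.
have sa4 : Num.sqrt a ^+ 4 = a ^+ 2.
  by rewrite (exprM _ 2 2) sqr_sqrtr// ltW.
by rewrite sa4 -mulrA -mulrDr ltr_pM2l// exprn_gt0.
Qed.

Lemma translate_rectangle (x : T) r b : 0 < x.2 -> 0 < r ->
  [set S_mul br x y | y in rectangle br r b] =
  N_ball br x.1 (Num.sqrt x.2 * r `^ b) `*` log_itv x.2 (ln r).
Proof.
move=> x0 r0; have sx0 : 0 < Num.sqrt x.2 by rewrite sqrtr_gt0.
have rb : 0 < r `^ b by rewrite powR_gt0.
have one (p : N) : N_ball br (N_one R mv mz) (r `^ b) p = (N_norm p < r `^ b) :> Prop.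
  rewrite /N_ball/= N_dist_diff /N_one/N_diff/= linear0l scaler0 !subr0.
  by case: p.
have translate (y : T) : N_ball br x.1 (Num.sqrt x.2 * r `^ b) (S_mul br x y).1 =
    N_ball br (N_one R mv mz) (r `^ b) y.1 :> Prop.
  by rewrite one /N_ball/= N_dist_translate// N_norm_dilate.
rewrite -itv_inv_log_itv//; apply/seteqP; split=> [_ [y [y1 y2] <-]|z [z1 z2]].
  split; first by rewrite translate.
  move: y2; rewrite /= !in_itv/= => /andP[h1 h2].
  by rewrite !ltr_pM2l ?h1.
(* The point x^-1 z in coordinates. *)
pose y : T := (((Num.sqrt x.2)^-1 *: (z.1.1 - x.1.1), x.2^-1 *: N_diff br x.1 z.1), z.2 / x.2).
have yz : S_mul br x y = z.
  case: z z1 z2 @y => [[X W] w] z1 z2; rewrite /S_mul/= /N_diff/=.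
  congr (_, _, _).
  - by rewrite scalerA divff ?gt_eqF// scale1r addrC subrK.
  - rewrite !linearZr_LR scalerA divff ?gt_eqF// scale1r scalerA.
    rewrite -mulrA divff ?gt_eqF// mulr1 linearBr brXX subr0.
    by apply/rowP => i; rewrite !mxE; lra.
  - by rewrite mulrC divfK ?gt_eqF.
exists y => //; split; first by rewrite -translate yz.
move: z2; rewrite /y/= !in_itv/= => /andP[h1 h2].
by rewrite ltr_pdivlMr// mulrC h1 ltr_pdivrMr// mulrC.
Qed.

(** With s = a^1/2 r^b and l = ln r one has ln s = ln a / 2 + b l, so b1 = b' and b2 = b''. *)
Lemma bounded_big_rectangles b' b'' : 2^-1 < b' < b'' ->
  bounded_L1_weak_L1 (maximal (big_rectangles br b' b'')).
Proof.
move=> /andP[b'_gt bb].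
apply: (@bounded_L1_weak_L1_big_sets R mv mz br brXX K K0 brK _ b' b'' 1 1) => //.
  by lra.
move=> B [x [r [b [x0 re /andP[bb' bb''] ->]]]] _.
have r0 : 0 < r by apply: lt_le_trans re; exact: expR_gt0.
have lr1 : 1 <= ln r by rewrite -[1]expRK ler_ln ?posrE ?expR_gt0.
have rb : 0 < r `^ b by rewrite powR_gt0.
have sx0 : 0 < Num.sqrt x.2 by rewrite sqrtr_gt0.
have s0 : 0 < Num.sqrt x.2 * r `^ b by exact: mulr_gt0.
exists x.1, x.2, (ln r), (Num.sqrt x.2 * r `^ b),
  (N_ball br x.1 (Num.sqrt x.2 * r `^ b)).
rewrite translate_rectangle// !mul1r; split=> //.
  by split=> //; [lra|exact: (open_N_ball K0 brK)].
rewrite lnM ?posrE// ln_sqrt// ln_powR !lerD2l.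
by rewrite !ler_pM2r ?(ltW bb') ?(ltW bb'')//; lra.
Qed.

(** With s = eta^k and l = ln r, the logarithm of the admissibility condition is the required
    comparison, for b1 = beta and b2 = 4 beta. *)
Lemma bounded_big_admissible (I : int -> countType) (Q : forall k, I k -> set N)
    (eta cN CN : R) (M : nat) (center : forall k, I k -> N) beta :
  0 < eta -> 0 < cN -> 0 < CN -> christ_sets br Q eta cN CN M center ->
  2^-1 < beta -> bounded_L1_weak_L1 (maximal (big_admissible Q eta beta)).
Proof.
move=> eta0 cN0 CN0 Qc b0.
apply: (@bounded_L1_weak_L1_big_sets R mv mz br brXX K K0 brK _ beta (4 * beta) cN CN) => //.
  by lra.
move=> B [k [al [a [r [a0 re /andP[h1 h2] ->]]]]] _.
have r0 : 0 < r by apply: lt_le_trans re; exact: expR_gt0.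
have lr1 : 1 <= ln r by rewrite -[1]expRK ler_ln ?posrE ?expR_gt0.
have sa0 : 0 < Num.sqrt a by rewrite sqrtr_gt0.
have e0 : 0 < eta ^ k by exact: exprz_gt0.
have lnE c : ln (Num.sqrt a * r `^ c) = ln a / 2 + c * ln r.
  by rewrite lnM ?posrE ?powR_gt0// ln_sqrt// ln_powR.
exists (center k al), a, (ln r), (eta ^ k), (Q k al).
have [Qin Qout] := christ_balls Qc al.
split=> //; last by rewrite itv_inv_log_itv.
  split=> //; [lra|exact: (christ_open Qc)].
by rewrite -!lnE !ler_ln ?posrE ?mulr_gt0 ?powR_gt0// h1 ltW.
Qed.

End big_families.

(** * Curves and the Riemannian metric *)

Section calculus.
Context (R : realType).

Lemma derive_affine (V W : normedModType R) (f : V -> W) (x u : V) (L : W) :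
  (forall h : R, f (h *: u + x) = f x + h *: L) -> 'D_u f x = L.
Proof.
move=> fL; rewrite /derive; apply: cvg_lim => //.
apply: cvg_near_cst; near=> h.
rewrite /= fL addrAC subrr add0r scalerA mulVf ?scale1r//.
by near: h; exact: nbhs_dnbhs_neq.
Unshelve. all: by end_near. Qed.

(* [phi] is affine with linear part [psi].                                    *)
Lemma is_derive_affine (V : normedModType R) (phi psi : V -> R)
    (c : R -> V) (t : R) : continuous psi ->
  (forall a x y, psi (a *: (x - y)) = a * (phi x - phi y)) -> derivable c t 1 ->
  is_derive t (1 : R) (fun t => phi (c t)) (psi ((c^`())%classic t)).
Proof.
move=> cpsi phipsi dc; rewrite derive1E.
have cv : (h^-1 *: (phi (c (h *: (1 : R) + t)) - phi (c t) : R^o)) @[h --> (0 : R)^'] -->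
    (psi ('D_1 c t) : R).
  rewrite (_ : (fun h : R => _) = (fun h : R => psi (h^-1 *: (c (h *: (1:R) + t) - c t)))).
    exact: (cvg_comp _ psi dc (cpsi _)).
  by apply/funext => h; rewrite phipsi.
by split; [apply/cvg_ex; exists (psi ('D_1 c t))|exact: (cvg_lim _ cv)].
Qed.

Variables (g : R -> R) (k : R).
Hypothesis g_cont : forall t : R, t \in `[0, 1] -> {for t, continuous g}.
Hypothesis g_ge0 : forall t : R, t \in `[0, 1] -> 0 <= g t.
Hypothesis k_ge0 : 0 <= k.
Local Notation mu := (@lebesgue_measure R).
Let G t : R := parameterized_integral mu 0 t g.

Let g_within : {within `[0, 1], continuous g}.
Proof. by apply: continuous_in_subspaceT => t /set_mem; exact: g_cont. Qed.

Let g_int : mu.-integrable `[0, 1] (EFin \o g).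
Proof. by apply: continuous_compact_integrable => //; exact: segment_compact. Qed.

Let derive_G (t : R) : t \in `]0, 1[ -> is_derive t 1 G (g t).
Proof.
rewrite in_itv/= => /andP[t0 t1].
have [|dG GE] := continuous_FTC1_closed t1 g_int t0.
  by apply: g_cont; rewrite in_itv/= !ltW.
by split=> //; rewrite -derive1E.
Qed.

(** k G - h is continuous on [0, 1] with nonnegative derivative inside, hence nondecreasing. *)
Let upper_bound (h dh : R -> R) (t : R) :
  (forall t : R, t \in `[0, 1] -> is_derive t 1 h (dh t)) ->
  (forall t : R, t \in `[0, 1] -> dh t <= k * g t) ->
  t \in `[0, 1] -> h t - h 0 <= k * G t.
Proof.
move=> dhP dhk t01.
have oc (s : R) : s \in `]0, 1[ -> s \in `[0, 1].
  by rewrite !in_itv/= => /andP[s0 s1]; rewrite !ltW.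
pose f := (k \*o G) \- h.
have df (s : R) : s \in `]0, 1[ -> is_derive s 1 f (k * g s - dh s).
  move=> s01; have := dhP _ (oc _ s01); have := derive_G s01 => dG dh'.
  exact: is_deriveB.
have G0 : G 0 = 0 by rewrite /G /parameterized_integral set_itv1 Rintegral_set1.
have := @ger0_derive1_le_cc R f 0 1 _ _ _ 0 t.
rewrite /f /= G0 mulr0 sub0r => H; rewrite lerBlDr addrC -lerBlDl -[leLHS]opprB opprB.
suff : - h 0 <= k * G t - h t by lra.
apply: H => //; last 2 first.
- by rewrite in_itv/= lexx ler01.
- by move: t01; rewrite in_itv/= => /andP[].
- by move=> s /df[].
- by move=> s s01; have [_ fE] := df _ s01; rewrite derive1E fE subr_ge0; exact/dhk/oc.
move=> s; apply: continuousB.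
  apply: continuousM; first exact: cvg_cst.
  exact: (parameterized_integral_continuous ler01 g_int).
apply: continuous_in_subspaceT => r /set_mem /= r01.
by apply: differentiable_continuous; apply/derivable1_diffP; have [] := dhP _ r01.
Qed.

(** The one-sided bound is applied to h and to -h; G is nondecreasing as g >= 0, so G t may be
    replaced by G 1. *)
Lemma derive_integral_bound (h dh : R -> R) (t : R) :
  (forall t : R, t \in `[0, 1] -> is_derive t 1 h (dh t)) ->
  (forall t : R, t \in `[0, 1] -> `|dh t| <= k * g t) ->
  t \in `[0, 1] -> `|h t - h 0| <= k * \int[mu]_(s in `[0%R, 1%R]) g s.
Proof.
move=> dhP dhk t01.
have GM : G t <= G 1.
  have oc (s : R) : s \in `]0, 1[ -> s \in `[0, 1].
    by rewrite !in_itv/= => /andP[s0 s1]; rewrite !ltW.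
  apply: (@ger0_derive1_le_cc R G 0 1) => //.
  - by move=> s /derive_G[].
  - by move=> s s01; have [_ gE] := derive_G s01; rewrite derive1E gE; exact/g_ge0/oc.
  - exact: (parameterized_integral_continuous ler01 g_int).
  - by rewrite in_itv/= lexx ler01.
  - by move: t01; rewrite in_itv/= => /andP[].
have kGM : k * G t <= k * G 1 by rewrite ler_wpM2l.
apply: le_trans kGM; rewrite ler_norml; apply/andP; split; last first.
  by apply: upper_bound dhP _ t01 => s /dhk; rewrite ler_norml => /andP[].
have := @upper_bound (\- h) (\- dh) t.
move=> /(_ _ _ t01) H; suff : (\- h) t - (\- h) 0 <= k * G t by rewrite /=; lra.
apply: H => s s01; first by apply: is_deriveN; exact: dhP.
by have := dhk _ s01; rewrite ler_norml /=; lra.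
Qed.

End calculus.

Section arcs.
Context (R : realType) (mv mz : nat).
Local Notation V := 'rV[R]_mv.
Local Notation Z := 'rV[R]_mz.
Local Notation N := (V * Z)%type.
Local Notation T := (N * R)%type.
Variable br : {bilinear V -> V -> Z}.
Hypothesis brXX : forall X, br X X = 0.
Variable K : R.
Hypothesis K0 : 0 <= K.
Hypothesis brK : forall X Y, `|br X Y| <= K * `|X| * `|Y|.

(** For x in S, the differential at x of the left translation by x^-1, applied to u. *)
Definition left_invariant_vector (x u : T) : T :=
  (((Num.sqrt x.2)^-1 *: u.1.1, x.2^-1 *: (u.1.2 - 2^-1 *: br x.1.1 u.1.1)),
   x.2^-1 * u.2).

(** Left multiplication is affine in its right argument, so its directional derivative is its linear
    part. *)
Lemma S_metricE (x u : T) : 0 < x.2 ->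
  S_metric br x u = s_norm (left_invariant_vector x u).
Proof.
move=> x0; rewrite /S_metric; congr s_norm; apply: derive_affine => h.
have sx0 : Num.sqrt x.2 != 0 by rewrite gt_eqF// sqrtr_gt0.
have sV : Num.sqrt x.2^-1 = (Num.sqrt x.2)^-1 by rewrite sqrtrV// ltW.
have ssE : (Num.sqrt x.2)^-1 * (Num.sqrt x.2)^-1 = x.2^-1.
  by rewrite -invfM -expr2 sqr_sqrtr// ltW.
rewrite /S_mul /S_inv /left_invariant_vector/= sV; congr (_, _, _).
- by apply/rowP => i; rewrite !mxE; ring.
- rewrite /= !linearNl !linearZl_LR linearDr linearZr_LR.
  apply/rowP => i; rewrite !mxE -ssE.
  by ring.
- by rewrite /= mulrDr mulrCA addrC.
Qed.

Lemma s_norm_ge0 (u : T) : 0 <= s_norm u. Proof. exact: sqrtr_ge0. Qed.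

Lemma norm_le_s_norm (u : T) :
  [/\ `|u.1.1| <= s_norm u, `|u.1.2| <= s_norm u & `|u.2| <= s_norm u].
Proof.
have := sqr_ge0 (enorm u.1.1); have := sqr_ge0 (enorm u.1.2); have := sqr_ge0 u.2.
move=> h3 h2 h1; split.
- apply: (le_trans (norm_le_enorm _)); rewrite -[leLHS]ger0_norm ?enorm_ge0//.
  by rewrite -sqrtr_sqr ler_wsqrtr//; lra.
- apply: (le_trans (norm_le_enorm _)); rewrite -[leLHS]ger0_norm ?enorm_ge0//.
  by rewrite -sqrtr_sqr ler_wsqrtr//; lra.
- by rewrite -sqrtr_sqr ler_wsqrtr//; lra.
Qed.

Lemma s_norm_le_sum (u : T) : s_norm u <= enorm u.1.1 + enorm u.1.2 + `|u.2|.
Proof.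
have h1 := enorm_ge0 u.1.1; have h2 := enorm_ge0 u.1.2; have h3 := normr_ge0 u.2.
rewrite -[leRHS]ger0_norm ?addr_ge0// -sqrtr_sqr ler_wsqrtr//.
rewrite -[u.2 ^+ 2]ger0_norm ?sqr_ge0// normrX.
by move: (enorm _) (enorm _) `|_| h1 h2 h3 => x y z h1 h2 h3; nra.
Qed.

Lemma continuous_s_norm : continuous (@s_norm R mv mz).
Proof.
move=> u; apply: (@continuous_comp _ _ _
  (fun u : T => enorm u.1.1 ^+ 2 + enorm u.1.2 ^+ 2 + u.2 ^+ 2) Num.sqrt);
  last exact: sqrt_continuous.
apply: cvgD; first apply: cvgD.
- apply: (@continuous_sqr_enorm R T _ (fun u => u.1.1)) => v.
  by apply: (@continuous_comp _ _ _ fst fst); [exact: cvg_fst|exact: cvg_fst].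
- apply: (@continuous_sqr_enorm R T _ (fun u => u.1.2)) => v.
  by apply: (@continuous_comp _ _ _ fst snd); [exact: cvg_fst|exact: cvg_snd].
by apply: cvgM; exact: cvg_snd.
Qed.

Lemma continuous_br2 : continuous (fun p : V * V => br p.1 p.2).
Proof.
rewrite (_ : (fun p : V * V => _) = fun p => \sum_i \sum_j
    (p.1 ord0 i * p.2 ord0 j) *: br (delta_mx 0 i) (delta_mx 0 j)); last first.
  apply/funext => -[X Y]; rewrite /= {1}[X]row_sum_delta linear_sumlz.
  apply: eq_bigr => i _; rewrite {1}[Y]row_sum_delta linear_sumr.
  by apply: eq_bigr => j _; rewrite linearZl_LR linearZr_LR scalerA.
apply: continuous_big => [|i _]; first exact: add_continuous.
apply: continuous_big => [|j _]; first exact: add_continuous.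
move=> p; apply: cvgZ; last exact: cvg_cst.
apply: cvgM.
  by apply: (@continuous_comp _ _ _ fst (fun X : V => X ord0 i));
    [exact: cvg_fst|exact: coord_continuous].
by apply: (@continuous_comp _ _ _ snd (fun X : V => X ord0 j));
  [exact: cvg_snd|exact: coord_continuous].
Qed.

End arcs.

Section arc_bounds.
Context (R : realType) (mv mz : nat).
Local Notation V := 'rV[R]_mv.
Local Notation Z := 'rV[R]_mz.
Local Notation N := (V * Z)%type.
Local Notation T := (N * R)%type.
Variable br : {bilinear V -> V -> Z}.
Hypothesis brXX : forall X, br X X = 0.
Variable K : R.
Hypothesis K0 : 0 <= K.
Hypothesis brK : forall X Y, `|br X Y| <= K * `|X| * `|Y|.

Section one_arc.
Variable c : R -> T.
Hypothesis arc_c : C1_arc c.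

Let dc (t : R) : T := (c^`())%classic t.
Let g (t : R) : R := s_norm (left_invariant_vector br (c t) (dc t)).

Let c_gt0 (t : R) : t \in `[0, 1] -> 0 < (c t).2.
Proof. by case: arc_c => _ _; exact. Qed.

Let c_cont (t : R) : {for t, continuous c}.
Proof.
by case: arc_c => /(_ t) /derivable1_diffP /differentiable_continuous.
Qed.

Let dc_cont (t : R) : {for t, continuous dc}.
Proof. by have [_ dcc _] := arc_c; exact: (dcc t). Qed.

Let g_cont (t : R) : t \in `[0, 1] -> {for t, continuous g}.
Proof.
move=> /c_gt0 a0; apply: (@continuous_comp _ _ _
  (fun t => left_invariant_vector br (c t) (dc t)) (@s_norm R mv mz));
  last exact: continuous_s_norm.
have ca : ((c s).2 @[s --> t]) --> (c t).2.
  by apply: (@continuous_comp _ _ _ c snd); [exact: c_cont|exact: cvg_snd].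
have cX : ((c s).1.1 @[s --> t]) --> (c t).1.1.
  by apply: (@continuous_comp _ _ _ c (fst \o fst)); [exact: c_cont|];
    apply: (@continuous_comp _ _ _ fst fst); exact: cvg_fst.
have cdX : ((dc s).1.1 @[s --> t]) --> (dc t).1.1.
  by apply: (@continuous_comp _ _ _ dc (fst \o fst)); [exact: dc_cont|];
    apply: (@continuous_comp _ _ _ fst fst); exact: cvg_fst.
have cdZ : ((dc s).1.2 @[s --> t]) --> (dc t).1.2.
  apply: (@continuous_comp _ _ _ dc (snd \o fst)); first exact: dc_cont.
  by apply: (@continuous_comp _ _ _ fst snd); [exact: cvg_fst|exact: cvg_snd].
have cda : ((dc s).2 @[s --> t]) --> (dc t).2.
  by apply: (@continuous_comp _ _ _ dc snd); [exact: dc_cont|exact: cvg_snd].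
have cVa : ((c s).2^-1 @[s --> t]) --> (c t).2^-1 by apply: cvgV => //; rewrite gt_eqF.
have csa : ((Num.sqrt (c s).2)^-1 @[s --> t]) --> (Num.sqrt (c t).2)^-1.
  apply: cvgV; first by rewrite gt_eqF// sqrtr_gt0.
  by apply: (@continuous_comp _ _ _ (fun s => (c s).2) Num.sqrt) => //; exact: sqrt_continuous.
have cbr : (br (c s).1.1 (dc s).1.1 @[s --> t]) --> br (c t).1.1 (dc t).1.1.
  apply: (@continuous_comp _ _ _ (fun s => ((c s).1.1, (dc s).1.1))
    (fun p : V * V => br p.1 p.2)); last exact: continuous_br2.
  exact: (cvg_pair cX cdX).
have ch : (2^-1 *: br (c s).1.1 (dc s).1.1 @[s --> t]) -->
    2^-1 *: br (c t).1.1 (dc t).1.1 by apply: cvgZr.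
have cJ : ((c s).2^-1 *: ((dc s).1.2 - 2^-1 *: br (c s).1.1 (dc s).1.1) @[s --> t]) -->
    (c t).2^-1 *: ((dc t).1.2 - 2^-1 *: br (c t).1.1 (dc t).1.1).
  by apply: cvgZ => //; exact: cvgB.
have cI : ((Num.sqrt (c s).2)^-1 *: (dc s).1.1 @[s --> t]) -->
    (Num.sqrt (c t).2)^-1 *: (dc t).1.1 by exact: cvgZ.
have cA : ((c s).2^-1 * (dc s).2 @[s --> t]) --> (c t).2^-1 * (dc t).2 by exact: cvgM.
exact: (cvg_pair (cvg_pair cI cJ) cA).
Qed.

Lemma arc_lengthE : arc_length br c =
  \int[@lebesgue_measure R]_(t in `[0%R, 1%R]) g t.
Proof.
rewrite /arc_length; apply: eq_Rintegral => t; rewrite inE/= => t01.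
by rewrite S_metricE// c_gt0.
Qed.

Lemma arc_length_ge0 : 0 <= arc_length br c.
Proof. by apply: Rintegral_ge0 => t _; exact: s_norm_ge0. Qed.

Lemma arc_length_le (B : R) :
  (forall t : R, t \in `[0, 1] -> S_metric br (c t) (dc t) <= B) ->
  arc_length br c <= B.
Proof.
move=> gB; rewrite arc_lengthE.
have -> : B = \int[@lebesgue_measure R]_(t in `[0%R, 1%R]) cst B t.
  have mu1 : @lebesgue_measure R `[0%R, 1%R] = 1%:E.
    by rewrite lebesgue_measure_itv/= lte_fin ltr01 -EFinB/= subr0.
  by rewrite Rintegral_cst// [X in fine X](mu1) mulr1.
apply: le_Rintegral => //.
- apply: continuous_compact_integrable; first exact: segment_compact.
  by apply: continuous_in_subspaceT => t /set_mem; exact: g_cont.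
- apply: continuous_compact_integrable; first exact: segment_compact.
  by apply: continuous_in_subspaceT => t _; exact: cvg_cst.
- by move=> t t01 /=; rewrite /g -S_metricE ?c_gt0//; exact: gB.
Qed.

Let bound (k : R) (h dh : R -> R) (t : R) : 0 <= k ->
  (forall t : R, t \in `[0, 1] -> is_derive t 1 h (dh t)) ->
  (forall t : R, t \in `[0, 1] -> `|dh t| <= k * g t) ->
  t \in `[0, 1] -> `|h t - h 0| <= k * arc_length br c.
Proof.
move=> k0; rewrite arc_lengthE; apply: derive_integral_bound => //.
by move=> s _; exact: s_norm_ge0.
Qed.

Let dX_le (t : R) : t \in `[0, 1] -> `|(dc t).1.1| <= Num.sqrt (c t).2 * g t.
Proof.
move=> /c_gt0 a0; have sa0 : 0 < Num.sqrt (c t).2 by rewrite sqrtr_gt0.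
have [+ _ _] := norm_le_s_norm (left_invariant_vector br (c t) (dc t)).
by rewrite /= normrZ gtr0_norm ?invr_gt0// ler_pdivrMl.
Qed.

Let dZ_le (t : R) : t \in `[0, 1] ->
  `|(dc t).1.2 - 2^-1 *: br (c t).1.1 (dc t).1.1| <= (c t).2 * g t.
Proof.
move=> /c_gt0 a0.
have [_ + _] := norm_le_s_norm (left_invariant_vector br (c t) (dc t)).
by rewrite /= normrZ gtr0_norm ?invr_gt0// ler_pdivrMl.
Qed.

Let da_le (t : R) : t \in `[0, 1] -> `|(c t).2^-1 * (dc t).2| <= g t.
Proof.
by have [_ _ +] := norm_le_s_norm (left_invariant_vector br (c t) (dc t)).
Qed.

(** The derivative a' / a of ln a is a component of the left-invariant velocity, hence at most its
    norm. *)
Lemma arc_ln_le (t : R) : t \in `[0, 1] ->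
  `|ln (c t).2 - ln (c 0).2| <= arc_length br c.
Proof.
have da (s : R) : is_derive s 1 (fun s => (c s).2) (dc s).2.
  apply: (@is_derive_affine R T snd snd) => [p|a x y|]; first exact: cvg_snd.
    by [].
  by case: arc_c.
rewrite -[leRHS]mul1r; apply: (@bound 1 (fun s => ln (c s).2)
  (fun s => (c s).2^-1 * (dc s).2)) => // s s01; last by rewrite mul1r da_le.
have dln := is_derive1_ln (c_gt0 s01).
exact: (is_derive1_comp dln (da s)).
Qed.

(** By [arc_ln_le], A^2 bounds the height along the whole arc, and A its square root. *)
Variable A : R.
Hypothesis A0 : 0 < A.
Hypothesis AP : (c 0).2 * expR (arc_length br c) <= A ^+ 2.

Let c_le (t : R) : t \in `[0, 1] -> (c t).2 <= A ^+ 2.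
Proof.
move=> t01; apply: le_trans AP; have a0 := c_gt0 t01.
have c00 : 0 < (c 0).2 by apply: c_gt0; rewrite in_itv/= lexx ler01.
rewrite -[leLHS]lnK ?posrE// -[(c 0).2]lnK ?posrE// -expRD ler_expR.
by have := arc_ln_le t01; rewrite ler_norml; lra.
Qed.

Let sqrt_c_le (t : R) : t \in `[0, 1] -> Num.sqrt (c t).2 <= A.
Proof.
move=> /c_le h; rewrite -[leRHS]gtr0_norm// -sqrtr_sqr.
exact: ler_wsqrtr.
Qed.

Let g_ge0 t : 0 <= g t. Proof. exact: s_norm_ge0. Qed.

Lemma arc_v_le (t : R) : t \in `[0, 1] ->
  `|(c t).1.1 - (c 0).1.1| <= A * arc_length br c.
Proof.
move=> t01; apply/norm_rV_le => [|i].
  by rewrite mulr_ge0 ?arc_length_ge0// ltW.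
rewrite !mxE; apply: (@bound A (fun s => (c s).1.1 ord0 i)
  (fun s => (dc s).1.1 ord0 i)) => //; first exact: ltW.
  move=> s _; apply: (@is_derive_affine R T (fun x : T => x.1.1 ord0 i)
    (fun x : T => x.1.1 ord0 i)) => [|a x y|].
  - move=> p; apply: (@continuous_comp _ _ _ (fun p : T => p.1.1) (fun X : V => X ord0 i)).
      by apply: (@continuous_comp _ _ _ fst fst); exact: cvg_fst.
    exact: coord_continuous.
  - by rewrite !mxE.
  - by case: arc_c.
move=> s s01; apply: (le_trans (ler_norm_rV _ _)); apply: (le_trans (dX_le s01)).
by rewrite ler_wpM2r// sqrt_c_le.
Qed.

(** The derivative in t of the difference is Z' - [X(0), X'] / 2. It splits into Z' - [X, X'] / 2,
    at most A^2 g, and [X - X(0), X'] / 2, which [arc_v_le] controls. *)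
Lemma arc_N_diff_le (t : R) : t \in `[0, 1] -> `|N_diff br (c 0).1 (c t).1| <=
  A ^+ 2 * (arc_length br c + K * arc_length br c ^+ 2).
Proof.
move=> t01; have L0 := arc_length_ge0; set L := arc_length br c in L0 *.
have k0 : 0 <= A ^+ 2 * (1 + K * L).
  by rewrite mulr_ge0 ?sqr_ge0// addr_ge0// mulr_ge0.
rewrite (_ : A ^+ 2 * _ = A ^+ 2 * (1 + K * L) * L); last by ring.
apply/norm_rV_le => [|i]; first by rewrite mulr_ge0.
pose phi (x : T) := N_diff br (c 0).1 x.1 ord0 i.
pose psi (x : T) := (x.1.2 - 2^-1 *: br (c 0).1.1 x.1.1) ord0 i.
have phi0 : phi (c 0) = 0 by rewrite /phi N_diff_refl// mxE.
have := @bound _ (phi \o c) (psi \o dc) t k0; rewrite /comp phi0 subr0.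
apply => //.
  move=> s _; apply: (@is_derive_affine R T phi psi) => [|a x y|].
  - move=> p; apply: (@continuous_comp _ _ _
      (fun x : T => x.1.2 - 2^-1 *: br (c 0).1.1 x.1.1) (fun X : Z => X ord0 i)).
      apply: cvgB; first by apply: (@continuous_comp _ _ _ fst snd);
        [exact: cvg_fst|exact: cvg_snd].
      apply: cvgZr; apply: (@continuous_comp _ _ _ (fun p : T => p.1.1) (br (c 0).1.1)).
        by apply: (@continuous_comp _ _ _ fst fst); exact: cvg_fst.
      exact: (continuous_br K0 brK).
    exact: coord_continuous.
  - rewrite /psi /phi /N_diff/= linearZr_LR linearBr !mxE; ring.
  - by case: arc_c.
move=> s s01; apply: (le_trans (ler_norm_rV _ _)).
have -> : (dc s).1.2 - 2^-1 *: br (c 0).1.1 (dc s).1.1 =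
    ((dc s).1.2 - 2^-1 *: br (c s).1.1 (dc s).1.1) +
    2^-1 *: br ((c s).1.1 - (c 0).1.1) (dc s).1.1.
  by rewrite linearBl; apply/rowP => j; rewrite !mxE; lra.
apply: (le_trans (ler_normD _ _)); rewrite normrZ gtr0_norm ?invr_gt0//.
have h1 : `|(dc s).1.2 - 2^-1 *: br (c s).1.1 (dc s).1.1| <= A ^+ 2 * g s.
  by apply: (le_trans (dZ_le s01)); rewrite ler_wpM2r// c_le.
have h2 : `|(dc s).1.1| <= A * g s.
  by apply: (le_trans (dX_le s01)); rewrite ler_wpM2r// sqrt_c_le.
have h3 : K * `|(c s).1.1 - (c 0).1.1| * `|(dc s).1.1| <= K * (A * L) * (A * g s).
  apply: ler_pM => //; first by rewrite mulr_ge0.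
  by rewrite ler_wpM2l// arc_v_le.
have h4 : 0 <= K * (A * L) * (A * g s).
  by have A1 := ltW A0; rewrite !mulr_ge0.
have := brK ((c s).1.1 - (c 0).1.1) (dc s).1.1.
have -> : A ^+ 2 * (1 + K * L) * g s = A ^+ 2 * g s + K * (A * L) * (A * g s) by ring.
lra.
Qed.

End one_arc.

End arc_bounds.

(** * Small balls *)

Section small_balls.
Context (R : realType) (mv mz : nat).
Local Notation V := 'rV[R]_mv.
Local Notation Z := 'rV[R]_mz.
Local Notation N := (V * Z)%type.
Local Notation T := (N * R)%type.
Variable br : {bilinear V -> V -> Z}.
Hypothesis brXX : forall X, br X X = 0.
Variable K : R.
Hypothesis K0 : 0 <= K.
Hypothesis brK : forall X Y, `|br X Y| <= K * `|X| * `|Y|.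

(** The bounds survive concatenation: the cross term in K (L + l)^2 pays for the bracket of the two
    displacements. The condition on A involves the total length, so the same A serves the first arc
    and the remaining path. *)
Lemma S_path_estimate x y l : S_path br x y l ->
  [/\ 0 < x.2, 0 < y.2, `|ln y.2 - ln x.2| <= l &
    forall A, 0 < A -> x.2 * expR l <= A ^+ 2 ->
      `|y.1.1 - x.1.1| <= A * l /\
      `|N_diff br x.1 y.1| <= A ^+ 2 * (l + K * l ^+ 2)].
Proof.
elim=> {x y l} [x x0|c y l arc_c _ [c10 y0 lny IH]].
  split=> //; first by rewrite subrr normr0.
  move=> A A0 _; rewrite subrr N_diff_refl// !normr0 !mulr0.
  by rewrite expr0n/= mulr0 addr0 mulr0.
have i0 : (0 : R) \in `[0, 1] by rewrite in_itv/= lexx ler01.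
have i1 : (1 : R) \in `[0, 1] by rewrite in_itv/= lexx ler01.
have c00 : 0 < (c 0).2 by case: arc_c => _ _ /(_ _ i0).
have lnc := arc_ln_le br arc_c i1.
have L0 := arc_length_ge0 br c; set L := arc_length br c in lnc L0 *.
have l0 : 0 <= l := le_trans (normr_ge0 _) lny.
split=> //.
  rewrite (_ : ln y.2 - _ = (ln y.2 - ln (c 1).2) + (ln (c 1).2 - ln (c 0).2)); last by ring.
  by apply: (le_trans (ler_normD _ _)); rewrite addrC lerD.
move=> A A0 AP.
have AL : (c 0).2 * expR L <= A ^+ 2.
  by apply: le_trans AP; rewrite ler_pM2l// ler_expR lerDl.
have Al : (c 1).2 * expR l <= A ^+ 2.
  apply: le_trans AP; rewrite expRD mulrA ler_pM2r ?expR_gt0//.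
  rewrite -[leLHS]lnK ?posrE// -[(c 0).2]lnK ?posrE// -expRD ler_expR.
  by move: lnc; rewrite ler_norml; lra.
have [IH1 IH2] := IH _ A0 Al.
have h1 := arc_v_le (br := br) arc_c A0 AL i1.
have h2 := arc_N_diff_le brXX K0 brK arc_c A0 AL i1.
rewrite -/L in h1 h2; split.
  rewrite (_ : y.1.1 - _ = (y.1.1 - (c 1).1.1) + ((c 1).1.1 - (c 0).1.1)).
    by apply: (le_trans (ler_normD _ _)); rewrite addrC mulrDr lerD.
  by rewrite addrA subrK.
apply: (le_trans (N_diff_trans_le brXX brK (c 0).1 (c 1).1 y.1)).
have h3 : K * `|(c 1).1.1 - (c 0).1.1| * `|y.1.1 - (c 1).1.1| <= K * (A * L) * (A * l).
  by apply: ler_pM => //; [rewrite mulr_ge0|rewrite ler_wpM2l].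
have h4 : 0 <= K * (A * L) * (A * l) by have A1 := ltW A0; rewrite !mulr_ge0.
have -> : A ^+ 2 * (L + l + K * (L + l) ^+ 2) = A ^+ 2 * (L + K * L ^+ 2) +
   A ^+ 2 * (l + K * l ^+ 2) + (K * (A * L) * (A * l) + K * (A * L) * (A * l)) by ring.
lra.
Qed.

Lemma S_path_cat x y z l m : S_path br x y l -> S_path br y z m ->
  S_path br x z (l + m).
Proof.
elim=> {x y l} [x _|c y l arc_c _ IH] yz; first by rewrite add0r.
by rewrite -addrA; apply: S_path_cons => //; exact: IH.
Qed.

Lemma S_ballP x r y : S_ball br x r y <->
  exists2 l, S_path br x y l & l < r.
Proof.
split=> [[_ /ereal_inf_lt[_ [l xyl <-]]]|[l xyl lr]].
  by rewrite lte_fin => lr; exists l.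
split; first by have [] := S_path_estimate xyl.
by apply: (@le_lt_trans _ _ l%:E); [apply: ereal_inf_lbound; exists l|rewrite lte_fin].
Qed.

Definition line (x y : T) (t : R) : T := x + t *: (y - x).

Lemma line_affine x y (t h : R) : line x y (h *: (1 : R) + t) = line x y t + h *: (y - x).
Proof. by rewrite /line [h *: (1 : R)]mulr1 scalerDl addrA addrAC. Qed.

Lemma derivable_line x y (t : R) : derivable (line x y) t 1.
Proof.
apply/cvg_ex; exists (y - x); apply: cvg_near_cst; near=> h.
rewrite /= line_affine addrAC subrr add0r scalerA mulVf ?scale1r//.
by near: h; exact: nbhs_dnbhs_neq.
Unshelve. all: by end_near. Qed.

Lemma derive1_line x y : (line x y)^`()%classic = cst (y - x).
Proof.
apply/funext => t; rewrite derive1E; apply: derive_affine => h.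
exact: line_affine.
Qed.

(** The terms come from the v-, z- and a-components of the velocity in [S_path_box]. *)
Definition box_length : R := 2 * mv.+1%:R + 2 * mz.+1%:R + 4.

(** From exp(-e) >= 1 - e and (1 + 2 e)(1 - e) = 1 + e (1 - 2 e) >= 1. *)
Lemma expR_le12 (e : R) : 0 <= e <= 2^-1 -> expR e <= 1 + 2 * e.
Proof.
move=> /andP[e0 e2]; have := expR_ge1Dx (- e); rewrite expRN => h.
have E0 := expR_gt0 e.
have h1 : (1 - e) * expR e <= 1 by rewrite -ler_pdivlMr// div1r.
have : (1 + 2 * e) * (1 - e) * expR e <= 1 + 2 * e.
  by rewrite -mulrA -[leRHS]mulr1 ler_wpM2l//; lra.
have h0 : 0 <= e * (1 - 2 * e) by rewrite mulr_ge0//; lra.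
have : expR e <= (1 + 2 * e) * (1 - e) * expR e by rewrite ler_peMl ?(ltW E0)//; lra.
by move=> h2 h3; exact: le_trans h3.
Qed.

Lemma log_itv_dist (a e y : R) : 0 < a -> 0 < e <= 2^-1 -> log_itv a e y ->
  a / 2 <= y /\ `|y - a| <= 2 * a * e.
Proof.
move=> a0 /andP[e0 e2]; rewrite /log_itv/= in_itv/= => /andP[h1 h2].
have h3 : expR e <= 1 + 2 * e by apply: expR_le12; rewrite ltW.
have h4 := expR_ge1Dx (- e).
have h5 : a * (1 - e) <= a * expR (- e) by rewrite ler_pM2l.
have h6 : a * expR e <= a * (1 + 2 * e) by rewrite ler_pM2l.
have h7 : 0 < a * e by rewrite mulr_gt0.
have h8 : a * e <= a / 2 by rewrite ler_pM2l.
split; first lra.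
by rewrite ler_norml; apply/andP; split; lra.
Qed.

(** The coordinate segment from x to y stays above height x.2 / 2, so dividing by the height along
    it costs only a constant. *)
Lemma S_path_box x y e : 0 < x.2 -> 0 < e <= 2^-1 ->
  N_box br x.1 (Num.sqrt x.2 * e) (x.2 * e) y.1 -> log_itv x.2 e y.2 ->
  exists2 l, S_path br x y l & l <= box_length * e.
Proof.
move=> x0 e02 [hX hZ] /(log_itv_dist x0 e02)[y2 ya].
have /andP[e0 e2] := e02.
have line2 t : t \in `[0, 1] -> x.2 / 2 <= (line x y t).2.
  move=> t01; have /andP[t0 t1] : 0 <= t <= 1 by move: t01; rewrite in_itv.
  rewrite (_ : (line x y t).2 = (1 - t) * x.2 + t * y.2); last first.
    by rewrite /line/= /GRing.scale/=; ring.
  have := ler_wpM2l t0 y2; have : 0 <= 1 - t by lra.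
  move=> t1' h; have : (1 - t) * (x.2 / 2) <= (1 - t) * x.2 by rewrite ler_wpM2l//; lra.
  lra.
have arc : C1_arc (line x y).
  split; first exact: derivable_line.
    by rewrite derive1_line => t; exact: cvg_cst.
  by move=> t /line2 h; apply: lt_le_trans h; rewrite divr_gt0.
have p0 : line x y 0 = x by rewrite /line scale0r addr0.
have p1 : line x y 1 = y by rewrite /line scale1r addrC subrK.
have y0 : 0 < y.2 by apply: lt_le_trans y2; rewrite divr_gt0.
exists (arc_length br (line x y) + 0).
  have : S_path br (line x y 1) y 0 by rewrite p1; exact: S_path_nil.
  by move=> /(S_path_cons arc); rewrite p0.
rewrite addr0; apply: arc_length_le => // t t01.
rewrite derive1_line /=.
have a2 := line2 _ t01; set a := (line x y t).2 in a2.
have a0 : 0 < a by apply: lt_le_trans a2; rewrite divr_gt0.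
have sa0 : 0 < Num.sqrt a by rewrite sqrtr_gt0.
rewrite S_metricE//; apply: (le_trans (s_norm_le_sum _)).
rewrite /left_invariant_vector/= -[x.2 + t *: _]/a.
rewrite !enormZ ?invr_ge0 ?(ltW a0) ?(ltW sa0)//.
(* By alternation [X + t (Y - X), Y - X] = [X, Y - X], so t disappears. *)
have -> : y.1.2 - x.1.2 - 2^-1 *: br (x.1.1 + t *: (y.1.1 - x.1.1)) (y.1.1 - x.1.1) =
    N_diff br x.1 y.1.
  by rewrite linearDl linearZl_LR brXX scaler0 addr0 /N_diff linearBr brXX subr0.
rewrite (_ : box_length * e = 2 * mv.+1%:R * e + 2 * mz.+1%:R * e + 4 * e); last first.
  by rewrite /box_length; ring.
apply: lerD; first apply: lerD.
- rewrite ler_pdivrMl//; apply: (le_trans (enorm_le_norm _)).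
  rewrite [leRHS](_ : _ = mv.+1%:R * (2 * Num.sqrt a * e)); last by ring.
  rewrite ler_wpM2l//; apply: (le_trans (ltW hX)); rewrite ler_pM2r//.
  rewrite -(@ler_pXn2r _ 2) ?nnegrE ?mulr_ge0// ?(ltW sa0)//.
  by rewrite exprMn !sqr_sqrtr ?(ltW x0) ?(ltW a0)//; lra.
- rewrite ler_pdivrMl//; apply: (le_trans (enorm_le_norm _)).
  rewrite [leRHS](_ : _ = mz.+1%:R * (2 * a * e)); last by ring.
  by rewrite ler_wpM2l//; apply: (le_trans (ltW hZ)); rewrite ler_pM2r//; lra.
rewrite normrM gtr0_norm ?invr_gt0// ler_pdivrMl//.
apply: (le_trans ya); rewrite mulrA ler_pM2r//; lra.
Qed.

(** A path of length l < r ending at y is prolonged, by segments of length at most (r - l) / 2, to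
    all points of a box around y. *)
Lemma open_S_ball x r : open (S_ball br x r).
Proof.
rewrite openE => y /S_ballP[l xyl lr].
have [_ y0 _ _] := S_path_estimate xyl.
have M0 : 0 < box_length by rewrite /box_length ltr_wpDl// addr_ge0// mulr_ge0.
pose e := Num.min 2^-1 ((r - l) / 2 / box_length).
have e0 : 0 < e by rewrite lt_min invr_gt0 ltr0n !divr_gt0 ?subr_gt0.
have eM : e * box_length <= (r - l) / 2.
  by rewrite -ler_pdivlMr// ge_min lexx orbT.
pose U : set T := (fst @^-1` N_box br y.1 (Num.sqrt y.2 * e) (y.2 * e)) `&`
  (snd @^-1` log_itv y.2 e).
have oU : open U.
  apply: openI; apply: open_comp.
  + by move=> z _; exact: cvg_fst.
  + exact: (open_N_box K0 brK).
  + by move=> z _; exact: cvg_snd.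
  + exact: interval_open.
have Uy : U y.
  split=> /=; last exact: log_itv_refl.
  by apply: N_box_refl => //; rewrite mulr_gt0// sqrtr_gt0.
apply: filterS (open_nbhs_nbhs (conj oU Uy)) => z [/= zN za].
have [|m yzm me] := S_path_box y0 _ zN za; first by rewrite e0 ge_min lexx.
apply/S_ballP; exists (l + m); first exact: S_path_cat yzm.
by rewrite mulrC in eM; lra.
Qed.

Lemma bounded_small_balls : bounded_L1_weak_L1 (maximal (small_balls br)).
Proof.
have M0 : 0 < box_length by rewrite /box_length ltr_wpDl// addr_ge0// mulr_ge0.
have M1 : 1 <= box_length.
  by rewrite /box_length -[leLHS]add0r lerD ?addr_ge0 ?mulr_ge0//; lra.
have K0' : (0 : R) <= K by [].
have K1 : 0 < 1 + K by lra.
(* Chosen so that c times the outer sizes fits in the box of parameter e = r / (4 box_length), whose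
   points are reached by paths of length at most r / 4. *)
pose c : R := (16 * (1 + K) * box_length)^-1.
have c0 : 0 < c by rewrite invr_gt0 !mulr_gt0.
have cM : c * (4 * (1 + K)) = (4 * box_length)^-1.
  by rewrite /c; field; rewrite !gt_eqF.
have Mle : (4 * box_length)^-1 <= 4^-1.
  by rewrite lef_pV2 ?posrE ?mulr_gt0// ler_peMr.
pose P : set (T * R) := [set j | [/\ 0 < j.1.2, 0 < j.2 & j.2 < 2^-1]].
have e14 (x : R) : x <= 1 -> expR x <= 4.
  move=> x1; apply: (@le_trans _ _ (expR (2^-1 + 2^-1))).
    by rewrite ler_expR; lra.
  have h : expR (2^-1 : R) <= 2 by apply: (le_trans (expR_le12 _)); lra.
  rewrite expRD (_ : 4 = 2 * 2); last by ring.
  by rewrite ler_pM// expR_ge0.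
(* For l < r < 1/2 one has e^l <= 4, so [S_path_estimate] applies with A = 2 a^1/2. The outer sizes
   bound A l and A^2 (l + K l^2) <= 4 (1 + K) a l. *)
apply: (@bounded_L1_weak_L1_box_family R mv mz br brXX K K0 brK _ _ P
  (fun j => S_ball br j.1 j.2) (fun j => j.1.1) (fun j => j.1.2) (fun j => j.2)
  (fun j => 2 * Num.sqrt j.1.2 * j.2) (fun j => 4 * (1 + K) * j.1.2 * j.2)
  (fun j => j.2) c 4 1) => //.
(* Path lengths are nonnegative, so a nonempty ball has r > 0. *)
- move=> B [x [r [x0 r2 ->]]] [y /S_ballP[l xyl lr]].
  exists (x, r) => //; split=> //=; apply: le_lt_trans lr.
  by have [_ _ + _] := S_path_estimate xyl; exact/le_trans/normr_ge0.
- by move=> j _; exact: open_S_ball.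
- by move=> [x r] [/= x0 r0 r2]; rewrite !mulr_gt0// sqrtr_gt0.
- move=> [x r] [/= x0 r0 r2]; rewrite !exprMn sqr_sqrtr ?(ltW x0)// mul1r.
  rewrite (_ : 4 * (1 + K) * x.2 * r = (4 * x.2 * r) * (1 + K)); last by ring.
  rewrite (_ : 2 ^+ 2 * x.2 * r ^+ 2 = (4 * x.2 * r) * r); last by ring.
  by rewrite ler_pM2l ?mulr_gt0//; lra.
- move=> [x r] [/= x0 r0 r2] y [/= yN ya]; apply/S_ballP.
  pose e := (4 * box_length)^-1 * r.
  have e0 : 0 < e by rewrite mulr_gt0// invr_gt0 mulr_gt0.
  have er : e <= 4^-1 * r by rewrite ler_pM2r.
  have ce : c * (4 * (1 + K)) * r = e by rewrite cM.
  have cr0 : 0 < c * r by rewrite mulr_gt0.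
  have crK : 0 <= c * r * K by rewrite mulr_ge0// ltW.
  have cre : 4 * (c * r) <= e by rewrite -ce; lra.
  have sx0 : 0 < Num.sqrt x.2 by rewrite sqrtr_gt0.
  have [|||l xyl le_] := @S_path_box x y e x0.
  + by apply/andP; split=> //; lra.
  + apply: N_box_le yN.
      rewrite (_ : c * _ = Num.sqrt x.2 * (2 * (c * r))); last by ring.
      by rewrite ler_pM2l//; lra.
    by rewrite -ce le_eqVlt; apply/orP; left; apply/eqP; ring.
  + by apply: log_itv_le ya => //; lra.
  exists l => //; apply: (le_lt_trans le_).
  rewrite /e invfM mulrA mulrCA mulrA mulrAC.
  rewrite [X in X * r](_ : _ = 4^-1); last by field; rewrite gt_eqF.
  lra.
- move=> [x r] [/= x0 r0 r2] y /S_ballP[l xyl lr].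
  have [_ y0 lny H] := S_path_estimate xyl.
  have l0 : 0 <= l := le_trans (normr_ge0 _) lny.
  have sx0 : 0 < Num.sqrt x.2 by rewrite sqrtr_gt0.
  have [] := H (2 * Num.sqrt x.2); first by rewrite mulr_gt0.
    rewrite exprMn sqr_sqrtr ?(ltW x0)// mulrC ler_pM2r// -natrX.
    by apply: e14; lra.
  rewrite exprMn sqr_sqrtr ?(ltW x0)// => h1 h2.
  split; last by apply/log_itvP => //; split=> //; exact: le_lt_trans lr.
  split=> /=; first by apply: (le_lt_trans h1); rewrite ltr_pM2l// mulr_gt0.
  apply: (le_lt_trans h2).
  rewrite (_ : 4 * (1 + K) * x.2 * r = 2 ^+ 2 * x.2 * ((1 + K) * r)); last by ring.
  rewrite ltr_pM2l ?mulr_gt0//.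
  apply: (@le_lt_trans _ _ ((1 + K) * l)); last by rewrite ltr_pM2l.
  rewrite mulrDl mul1r lerD2l ler_wpM2l// expr2 ler_piMr//; lra.
move=> [x r] [x' r'] [/= x0 r0 r2] [/= x'0 r'0 r'2] rr.
case=> y [/(log_itvP _ _ x0)[y0 h1] /(log_itvP _ _ x'0)[_ h2]].
(* The intervals meet, so |ln a - ln a'| < r + r' < 1 and a' <= e a <= 4 a. *)
have xx : x'.2 <= 4 * x.2.
  rewrite mulrC; apply: (@le_trans _ _ (x.2 * expR 1)); last by rewrite ler_pM2l// e14.
  rewrite -[leLHS]lnK ?posrE// -{1}[x.2]lnK ?posrE// -expRD ler_expR.
  by move: h1 h2; rewrite !ltr_norml; lra.
have sxx : Num.sqrt x'.2 <= 2 * Num.sqrt x.2.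
  rewrite -(@ler_pXn2r _ 2) ?nnegrE ?mulr_ge0 ?sqrtr_ge0//.
  by rewrite exprMn !sqr_sqrtr ?(ltW x0) ?(ltW x'0)// -natrX.
have sx0 : 0 < Num.sqrt x.2 by rewrite sqrtr_gt0.
split; last by lra.
  rewrite (_ : 4 * _ = (2 * (2 * Num.sqrt x.2)) * (2 * r)); last by ring.
  by apply: ler_pM; rewrite ?mulr_ge0 ?sqrtr_ge0 ?ler_pM2l//; lra.
rewrite (_ : 4 * (4 * _ * _ * _) = 4 * (1 + K) * (4 * x.2) * r); last by ring.
by apply: ler_pM; rewrite ?mulr_ge0 ?ler_pM2l ?mulr_gt0//; lra.
Qed.

End small_balls.

(** * The H-type bracket in coordinates *)

Section coord_bracket.
Context (R : realType) (g : htype_algebra R) (mv mz : nat).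
Variables (ev : mv.-tuple g) (ez : mz.-tuple g).

Let vect (X : 'rV[R]_mv) : g := \sum_(i < mv) X ord0 i *: tnth ev i.

Let vect_linear a X Y : vect (a *: X + Y) = a *: vect X + vect Y.
Proof.
rewrite /vect scaler_sumr -big_split; apply: eq_bigr => i _ /=.
by rewrite !mxE scalerDl scalerA.
Qed.

(** Bilinearity yields the bound [K] through [bilinear_bounded], and alternation the cancellations
    in [N_diff]. *)
Lemma coord_bracket_bilinear : bilinear_for *:%R *:%R (coord_bracket ev ez).
Proof.
split=> [Y a X X'|X a Y Y']; apply/rowP => k; rewrite !mxE -/(vect _) -/(vect _).
  by rewrite vect_linear linearPl linearPl.
by rewrite vect_linear linearPr linearPl.
Qed.

HB.instance Definition _ := @bilinear_isBilinear.Build R _ _ _ *:%R *:%R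
  (coord_bracket ev ez) coord_bracket_bilinear.

Lemma coord_bracket_alternating X : coord_bracket ev ez X X = 0.
Proof. by apply/rowP => k; rewrite !mxE htype_alternating linear0l. Qed.

End coord_bracket.

Theorem theorem2p8 (R : realType) (g : htype_algebra R) (mv mz : nat)
    (ev : mv.-tuple g) (ez : mz.-tuple g)
    (ev_basis : orthonormal_basis (htype_v g) ev)
    (ez_basis : orthonormal_basis (htype_z g) ez)
    (b' b'' : R) (b'_lt_b'' : 2^-1 < b' < b'')
    (I : int -> countType) (Q : forall k, I k -> set ('rV[R]_mv * 'rV[R]_mz))
    (eta cN CN : R) (M : nat) (center : forall k, I k -> 'rV[R]_mv * 'rV[R]_mz)
    (eta_gt1 : 1 < eta) (cN_gt0 : 0 < cN) (CN_gt0 : 0 < CN)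
    (Q_christ : christ_sets (coord_bracket ev ez) Q eta cN CN M center)
    (c3 : R)
    (c3P : forall r : R, 1 < r ->
      S_ball (coord_bracket ev ez) (S_one R mv mz) (ln r) `<=`
      N_ball (coord_bracket ev ez) (N_one R mv mz) (c3 * r) `*` `]r^-1, r[)
    (beta : R)
    (beta_gt : Num.max (Num.max (3 / 2) (1 / 4 + ln eta)) (1 + ln (c3 / cN))
               < beta) :
  [/\ bounded_L1_weak_L1 (maximal (small_balls (coord_bracket ev ez))),
      bounded_L1_weak_L1 (maximal (big_rectangles (coord_bracket ev ez) b' b''))
    & bounded_L1_weak_L1 (maximal (big_admissible Q eta beta))].
Proof.
have alt := @coord_bracket_alternating R g mv mz ev ez.
have [K K0 brK] := bilinear_bounded (coord_bracket ev ez).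
split.
- exact: bounded_small_balls alt K K0 brK.
- exact: bounded_big_rectangles alt K K0 brK b' b'' b'_lt_b''.
have beta_gt32 : 3 / 2 < beta.
  by apply: le_lt_trans beta_gt; rewrite !le_max lexx.
apply: bounded_big_admissible alt K K0 brK _ _ _ _ _ _ _ _ _ cN_gt0 CN_gt0 Q_christ _; lra.
Qed.
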